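(* Let $w\in\mathbb R^n$ be an $L$-generic direction, $\Lambda\in\mathfrak L_\beta$ and $K\in\mathcal A_w(\Lambda)$. Then $$\mathcal C^{<}_{\Lambda,w,K}=\mathrm{Sol}_{\mathbb C[y]}\bigl(\mathfrak Q^{<K}_{\Lambda,w}:\partial_y^{K}\bigr).$$ Equivalently, $$\mathrm{Ann}_S\bigl(\mathcal C^{<}_{\Lambda,w,K}\bigr)=\mathfrak Q^{<K}_{\Lambda,w}:\partial_y^{K}.$$ Moreover, the following conditions are equivalent. (1) $v_{\Lambda,K}\in\mathrm{Rexp}_w(\Lambda)$. (2) $\mathcal C^{<}_{\Lambda,w,K}\ne0$. (3) $\mathfrak Q^{<K}_{\Lambda,w}:\partial_y^{K}\ne S$. Consequently, $$\mathrm{Rexp}_w(\Lambda)=\{v_{\Lambda,K}\mid K\in\mathcal A_w(\Lambda),\ \mathfrak Q^{<K}_{\Lambda,w}:\partial_y^{K}\ne S\}.$$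
   Context: Basics. $\mathbb N=\{0,1,2,\dots\}$, $[n]=\{1,\dots,n\}$. $A=(a_{ij})\in\mathrm{Mat}_{d\times n}(\mathbb Z)$ has rank $d$, $\beta\in\mathbb C^d$, $L=\mathrm{Ker}_{\mathbb Z}(A)$. An exponent lattice is a coset $\Lambda=\lambda+L$ with $\lambda\in\mathbb C^n$, $A\lambda=\beta$; $\mathfrak L_\beta$ is the set of all of them. Hypergeometric ideal. $D=\mathbb C\langle x_1,\dots,x_n,\partial_{x_1},\dots,\partial_{x_n}\rangle$ is the Weyl algebra, $\theta_{x_j}=x_j\partial_{x_j}$, $(A\theta_x)_i=\sum_ja_{ij}\theta_{x_j}$. For $u\in\mathbb Z^n$ write $u=u_+-u_-$ with $u_\pm\in\mathbb N^n$ of disjoint support. $I_A=\langle\partial_x^{u_+}-\partial_x^{u_-}\mid u\in L\rangle\subset\mathbb C[\partial_x]$, $H_A(\beta)=DI_A+\sum_{i=1}^dD((A\theta_x)_i-\beta_i)$. Formal series. $S=\mathbb C[\partial_{y_1},\dots,\partial_{y_n}]$ acts on $\mathbb C[y]$ by differentiation, written $\bullet$; $(A\partial_y)_i=\sum_ja_{ij}\partial_{y_j}$; $\partial_y^K=\prod_{j\in K}\partial_{y_j}$. $\widetilde\Lambda=\Lambda+\mathbb Z^n$. $\mathscr F^{\log}_{\widetilde\Lambda}$ is the space of all formal (possibly infinite) sums $\sum_{\gamma\in\widetilde\Lambda}x^\gamma p_\gamma(\log x)$, $p_\gamma\in\mathbb C[y]$, with coefficientwise equality, on which $D$ acts coefficientwise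 by $x_j\bullet(x^\gamma p(\log x))=x^{\gamma+e_j}p(\log x)$, $\partial_{x_j}\bullet(x^\gamma p(\log x))=x^{\gamma-e_j}((\gamma_j+\partial_{y_j})\bullet p)(\log x)$. $\mathrm{Supp}(\varphi)=\{\gamma\mid p_\gamma\ne0\}$. Supports and direction. $\mathrm{nsupp}(\gamma)=\{j\in[n]\mid\gamma_j\in\mathbb Z_{<0}\}$; $\Lambda_I=\{\gamma\in\Lambda\mid\mathrm{nsupp}(\gamma)=I\}$; $\mathrm{NS}(\Lambda)=\{I\mid\Lambda_I\ne\emptyset\}$. $w$ is $L$-generic if $w\cdot u\ne0$ for all $u\in L\setminus\{0\}$. On $\Lambda$, $\gamma\le_w\gamma'$ iff $w\cdot(\gamma'-\gamma)\ge0$ (a total order). $\mathcal B_w(\Lambda)$ is the set of $I\in\mathrm{NS}(\Lambda)$ such that $\{w\cdot(\gamma-\lambda)\mid\gamma\in\Lambda_I\}$ is bounded below in $\mathbb R$ (for one, equivalently any, $\lambda\in\Lambda$); for $I\in\mathcal B_w(\Lambda)$, $v_{\Lambda,I}$ is the (existing, unique) $\le_w$-minimum of $\Lambda_I$. $\mathcal A_w(\Lambda)$ is the set of $I\in\mathrm{NS}(\Lambda)$ such that every $J\in\mathrm{NS}(\Lambda)$ with $J\subset I$ lies in $\mathcal B_w(\Lambda)$; thus $\mathcal A_w(\Lambda)\subset\mathcal B_w(\Lambda)$. Solutions. $\mathrm{Sol}^{\mathrm{dir}}_{w,\Lambda}(H_A(\beta))$ is the set of $\varphi\in\mathscr F^{\log}_{\widetilde\Lambda}$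 with $\mathrm{Supp}(\varphi)\subset\Lambda$ and $H_A(\beta)\bullet\varphi=0$ such that $\varphi=0$ or $\mathrm{Supp}(\varphi)$ has a $\le_w$-minimum; for $\varphi\ne0$ this minimum is $\mathrm{lexp}_w(\varphi)$. $\mathrm{Rexp}_w(\Lambda)=\{\mathrm{lexp}_w(\varphi)\mid0\ne\varphi\in\mathrm{Sol}^{\mathrm{dir}}_{w,\Lambda}(H_A(\beta))\}$. Coefficient space. $\mathrm{Coeff}^{\mathrm{dir}}_w(\Lambda)$ is the space of families $(c_{\Lambda,I})_{I\in\mathrm{NS}(\Lambda)}$ in $\mathbb C[y]$ with $(A\partial_y)_i\bullet c_{\Lambda,I}=0$ for all $I,i$; $\partial_y^{J\setminus I}\bullet c_{\Lambda,I}=\partial_y^{I\setminus J}\bullet c_{\Lambda,J}$ for all $I,J\in\mathrm{NS}(\Lambda)$; and $c_{\Lambda,I}=0$ for $I\in\mathrm{NS}(\Lambda)\setminus\mathcal A_w(\Lambda)$. For $K\in\mathcal A_w(\Lambda)$, $\mathcal A^{<K}_w(\Lambda)=\{J\in\mathcal A_w(\Lambda)\mid v_{\Lambda,J}<_wv_{\Lambda,K}\}$, and $\mathcal C^{<}_{\Lambda,w,K}\subset\mathbb C[y]$ is the set of components $c_{\Lambda,K}$ of families $(c_{\Lambda,J})_J\in\mathrm{Coeff}^{\mathrm{dir}}_w(\Lambda)$ with $c_{\Lambda,J}=0$ for all $J\in\mathcal A^{<K}_w(\Lambda)$. Ideals of $S$. $\mathfrak e_A=\langle(A\partial_y)_i\mid1\le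 i\le d\rangle$; $\mathfrak M_\Lambda=\langle\partial_y^I\mid I\in\mathrm{NS}(\Lambda)\rangle$; $\mathfrak P^{<K}_{\Lambda,w}=\langle\partial_y^J\mid J\in(\mathrm{NS}(\Lambda)\setminus\mathcal A_w(\Lambda))\cup\mathcal A^{<K}_w(\Lambda)\rangle$ (zero if the index set is empty); $\mathfrak Q^{<K}_{\Lambda,w}=\mathfrak e_A\mathfrak M_\Lambda+\mathfrak P^{<K}_{\Lambda,w}$. $\mathfrak Q:f=\{g\in S\mid gf\in\mathfrak Q\}$. For an ideal $\mathfrak a\subset S$, $\mathrm{Sol}_{\mathbb C[y]}(\mathfrak a)=\{p\in\mathbb C[y]\mid f\bullet p=0\text{ for all }f\in\mathfrak a\}$; for $V\subset\mathbb C[y]$, $\mathrm{Ann}_S(V)=\{f\in S\mid f\bullet p=0\text{ for all }p\in V\}$. *)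

(* Defs.v *)
From HB Require Import structures.
From mathcomp Require Import all_boot all_order all_algebra generic_quotient.
From mathcomp Require Import boolp classical_sets functions reals.
From mathcomp Require Import complex.
From mathcomp Require monalg.
From mathcomp Require Import mpoly.

Set Implicit Arguments.
Unset Strict Implicit.
Unset Printing Implicit Defensive.

Import Order.TTheory GRing.Theory Num.Theory.

Local Open Scope quotient_scope.
Local Open Scope classical_set_scope.
Local Open Scope ring_scope.

(* In a noncommutative ring, [ideal_span] is the generated *left* ideal. *)
Definition ideal_span (T : pzRingType) (G : set T) : set T :=
  [set f | exists2 s : seq (T * T), (forall p, p \in s -> G p.2) &
           f = \sum_(p <- s) p.1 * p.2].

Definition ideal_add (T : pzRingType) (a b : set T) : set T :=
  [set f | exists f1 f2, [/\ a f1, b f2 & f = f1 + f2]].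

Definition ideal_mul (T : pzRingType) (a b : set T) : set T :=
  ideal_span [set f | exists f1 f2, [/\ a f1, b f2 & f = f1 * f2]].

Definition colon (T : pzRingType) (a : set T) (f : T) : set T :=
  [set g | a (g * f)].

Section TwoSidedQuotient.
Variables (T : pzRingType) (G : set T).

Definition two_sided_span : set T :=
  [set f | exists2 s : seq (T * T * T), (forall p, p \in s -> G p.1.2) &
           f = \sum_(p <- s) p.1.1 * p.1.2 * p.2].

Lemma two_sided_gen g : G g -> two_sided_span g.
Proof.
move=> Gg; exists [:: (1, g, 1)]; last by rewrite big_seq1 mul1r mulr1.
by move=> p; rewrite inE => /eqP ->.
Qed.

Lemma two_sided0 : two_sided_span 0.
Proof. by exists [::] => //; rewrite big_nil. Qed.

Lemma two_sidedD f g :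
  two_sided_span f -> two_sided_span g -> two_sided_span (f + g).
Proof.
move=> [s Gs ->] [t Gt ->]; exists (s ++ t); last by rewrite big_cat.
by move=> p; rewrite mem_cat => /orP[/Gs|/Gt].
Qed.

Lemma two_sidedMl h f : two_sided_span f -> two_sided_span (h * f).
Proof.
move=> [s Gs ->]; exists [seq (h * p.1.1, p.1.2, p.2) | p <- s].
  by move=> _ /mapP[p /Gs Gp ->].
by rewrite big_map mulr_sumr; apply: eq_bigr => p _; rewrite !mulrA.
Qed.

Lemma two_sidedMr h f : two_sided_span f -> two_sided_span (f * h).
Proof.
move=> [s Gs ->]; exists [seq (p.1.1, p.1.2, p.2 * h) | p <- s].
  by move=> _ /mapP[p /Gs Gp ->].
by rewrite big_map mulr_suml; apply: eq_bigr => p _; rewrite !mulrA.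
Qed.

Lemma two_sidedN f : two_sided_span f -> two_sided_span (- f).
Proof. by rewrite -mulN1r; apply: two_sidedMl. Qed.

Definition quot_rel (f g : T) : bool := `[< two_sided_span (f - g) >].

Lemma quot_rel_equiv : equiv_class_of quot_rel.
Proof.
split=> [f|f g|g f h].
- by apply/asboolP; rewrite subrr; apply: two_sided0.
- by apply/asboolP/asboolP => /two_sidedN; rewrite opprB.
- move=> /asboolP fg /asboolP gh; apply/asboolP.
  by rewrite -(subrK g f) -addrA; apply: two_sidedD.
Qed.
Canonical quot_rel_equivRel := EquivRelPack quot_rel_equiv.

Definition quot_ring := {eq_quot quot_rel}.
HB.instance Definition _ := EqQuotient.on quot_ring.
HB.instance Definition _ := Choice.on quot_ring.

Definition quot_pi (f : T) : quot_ring := \pi_quot_ring f.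

Lemma quot_ringP (f g : T) :
  quot_pi f = quot_pi g <-> two_sided_span (f - g).
Proof.
split=> [/eqmodP/asboolP //|fg].
by apply/eqmodP/asboolP.
Qed.

Lemma repr_quot (f : T) : two_sided_span (repr (quot_pi f) - f).
Proof. apply/quot_ringP; exact: (reprK (quot_pi f)). Qed.

Definition quot0 : quot_ring := quot_pi 0.
Definition quot1 : quot_ring := quot_pi 1.
Definition quotN (x : quot_ring) := quot_pi (- repr x).
Definition quotD (x y : quot_ring) := quot_pi (repr x + repr y).
Definition quotM (x y : quot_ring) := quot_pi (repr x * repr y).

Lemma quot_piN f : quotN (quot_pi f) = quot_pi (- f).
Proof.
by apply/quot_ringP; rewrite -opprD; apply/two_sidedN/repr_quot.
Qed.

Lemma quot_piD f g : quotD (quot_pi f) (quot_pi g) = quot_pi (f + g).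
Proof.
apply/quot_ringP; rewrite opprD addrACA.
by apply: two_sidedD; apply: repr_quot.
Qed.

Lemma quot_piM f g : quotM (quot_pi f) (quot_pi g) = quot_pi (f * g).
Proof.
apply/quot_ringP; set f' := repr _; set g' := repr _.
have -> : f' * g' - f * g = f' * (g' - g) + (f' - f) * g.
  by rewrite mulrBr mulrBl addrA subrK.
by apply: two_sidedD; [apply: two_sidedMl|apply: two_sidedMr]; apply: repr_quot.
Qed.

Lemma quot_ind (P : quot_ring -> Prop) : (forall f, P (quot_pi f)) -> forall x, P x.
Proof. by move=> Pf x; rewrite -(reprK x); apply: Pf. Qed.

Lemma quotDA : associative quotD.
Proof.
by elim/quot_ind=> f; elim/quot_ind=> g; elim/quot_ind=> h; rewrite !quot_piD addrA.
Qed.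
Lemma quotDC : commutative quotD.
Proof. by elim/quot_ind=> f; elim/quot_ind=> g; rewrite !quot_piD addrC. Qed.
Lemma quot0D : left_id quot0 quotD.
Proof. by elim/quot_ind=> f; rewrite quot_piD add0r. Qed.
Lemma quotND : left_inverse quot0 quotN quotD.
Proof. by elim/quot_ind=> f; rewrite quot_piN quot_piD addNr. Qed.
Lemma quotMA : associative quotM.
Proof.
by elim/quot_ind=> f; elim/quot_ind=> g; elim/quot_ind=> h; rewrite !quot_piM mulrA.
Qed.
Lemma quot1M : left_id quot1 quotM.
Proof. by elim/quot_ind=> f; rewrite quot_piM mul1r. Qed.
Lemma quotM1 : right_id quot1 quotM.
Proof. by elim/quot_ind=> f; rewrite quot_piM mulr1. Qed.
Lemma quotMDl : left_distributive quotM quotD.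
Proof.
elim/quot_ind=> f; elim/quot_ind=> g; elim/quot_ind=> h.
by rewrite quot_piD !quot_piM quot_piD mulrDl.
Qed.
Lemma quotMDr : right_distributive quotM quotD.
Proof.
elim/quot_ind=> f; elim/quot_ind=> g; elim/quot_ind=> h.
by rewrite quot_piD !quot_piM quot_piD mulrDr.
Qed.

HB.instance Definition _ :=
  GRing.isZmodule.Build quot_ring quotDA quotDC quot0D quotND.
HB.instance Definition _ := GRing.Zmodule_isPzRing.Build quot_ring
  quotMA quot1M quotM1 quotMDl quotMDr.
End TwoSidedQuotient.

(* The exponent of a formal series is a column vector; the series itself is   *)
(* the map sending gamma to p_gamma in the sum of the x^gamma p_gamma(log x). *)
Notation logseries K n := ('cV[K]_n -> {mpoly K[n]}).

Section Weyl.
Import monalg finmap.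
Variables (K : comNzRingType) (n : nat).

(* C<x, d>, with the letters x_j encoded as [inl j] and d_j as [inr j]. *)
Definition free_alg := {malg K[{fmonom ('I_n + 'I_n)%type}]}.
Definition free_x (j : 'I_n) : free_alg := << fmu (inl j) >>.
Definition free_d (j : 'I_n) : free_alg := << fmu (inr j) >>.

Definition weyl_relators : set free_alg :=
  [set f | exists i j,
     [\/ f = free_x i * free_x j - free_x j * free_x i,
         f = free_d i * free_d j - free_d j * free_d i
       | f = free_d i * free_x j - free_x j * free_d i - (i == j)%:R]].

Definition weyl := quot_ring weyl_relators.
HB.instance Definition _ := GRing.PzRing.on weyl.

Definition weyl_x (j : 'I_n) : weyl := quot_pi weyl_relators (free_x j).
Definition weyl_d (j : 'I_n) : weyl := quot_pi weyl_relators (free_d j).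
Definition weyl_c (c : K) : weyl := quot_pi weyl_relators (c *: 1).

Local Notation V := (logseries K n).

(* Coefficients of x_j . phi and d_j . phi at gamma: the contributing term of *)
(* phi sits at gamma - e_j, resp. gamma + e_j.                                *)
Definition letter_act (l : 'I_n + 'I_n) (phi : V) : V :=
  match l with
  | inl j => fun gam => phi (gam - delta_mx j 0)
  | inr j => fun gam => let gam' := gam + delta_mx j 0 in
               gam' j 0 *: phi gam' + mderiv j (phi gam')
  end.

Definition word_act (s : seq ('I_n + 'I_n)) (phi : V) : V :=
  foldr letter_act phi s.

Definition free_act (P : free_alg) (phi : V) : V :=
  \sum_(s <- msupp P) mcoeff s P *: word_act s phi.

(* Independent of the representative, by [weyl_act_pi] below. *)
Definition weyl_act (P : weyl) (phi : V) : V := free_act (repr P) phi.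

Lemma letter_act_linear l (c : K) (phi psi : V) :
  letter_act l (c *: phi + psi) =
  c *: letter_act l phi + letter_act l psi.
Proof.
have addE (f g : V) x : (f + g) x = f x + g x by [].
have scaleE (a : K) (f : V) x : (a *: f) x = a *: f x by [].
apply/funext => gam; case: l => j //=; rewrite !(addE, scaleE).
rewrite mderivD mderivZ scalerDr scalerDr !scalerA addrACA.
by rewrite [_ * c]mulrC.
Qed.

Lemma word_act_linear s (c : K) (phi psi : V) :
  word_act s (c *: phi + psi) =
  c *: word_act s phi + word_act s psi.
Proof. by elim: s => //= l s ->; rewrite letter_act_linear. Qed.

Lemma word_act_cat s t phi : word_act (s ++ t) phi = word_act s (word_act t phi).
Proof. by rewrite /word_act foldr_cat. Qed.

Lemma word_act0 s : word_act s 0 = 0.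
Proof.
have := word_act_linear s (-1) 0 0.
by rewrite !scaleN1r oppr0 addr0 addNr.
Qed.
Lemma free_actEw (d : {fset {fmonom ('I_n + 'I_n)%type}}) (P : free_alg) phi :
  (msupp P `<=` d)%fset ->
  free_act P phi = \sum_(s <- d) mcoeff s P *: word_act s phi.
Proof.
move=> le; rewrite /free_act [LHS](big_fset_incl _ le) => //= x xd.
by move=> /mcoeff_outdom ->; rewrite scale0r.
Qed.

Lemma free_actU (c : K) s phi : free_act << c *g s >> phi = c *: word_act s phi.
Proof. by rewrite (free_actEw _ msuppU_le) big_seq_fset1 mcoeffUU. Qed.

Lemma free_act0 phi : free_act 0 phi = 0.
Proof. by rewrite /free_act msupp0 big_seq_fset0. Qed.

Lemma free_actD P Q phi : free_act (P + Q) phi = free_act P phi + free_act Q phi.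
Proof.
rewrite (free_actEw _ (msuppD_le P Q)) (free_actEw _ (fsubsetUl _ (msupp Q))).
rewrite (free_actEw _ (fsubsetUr (msupp P) _)) -big_split /=.
by apply: eq_bigr => s _; rewrite mcoeffD scalerDl.
Qed.

Lemma free_act_sum (I : Type) (r : seq I) (F : I -> free_alg) phi :
  free_act (\sum_(i <- r) F i) phi = \sum_(i <- r) free_act (F i) phi.
Proof.
by apply: (big_morph (free_act^~ phi)) => [P Q|]; rewrite ?free_actD ?free_act0.
Qed.

Lemma free_actN P phi : free_act (- P) phi = - free_act P phi.
Proof. by apply/eqP; rewrite -addr_eq0 -free_actD addNr free_act0. Qed.

Lemma word_act_sum (I : Type) (r : seq I) (c : I -> K) (F : I -> V) s :
  word_act s (\sum_(i <- r) c i *: F i) = \sum_(i <- r) c i *: word_act s (F i).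
Proof.
elim: r => [|i r IH]; first by rewrite !big_nil word_act0.
by rewrite !big_cons word_act_linear IH.
Qed.

Lemma free_actM P Q phi : free_act (P * Q) phi = free_act P (free_act Q phi).
Proof.
rewrite malgME free_act_sum; apply: eq_bigr => s _.
rewrite free_act_sum [in RHS]/free_act word_act_sum scaler_sumr.
apply: eq_bigr => t _; rewrite free_actU scalerA; congr (_ *: _).
by rewrite -word_act_cat -[mul s t]/(fmmul s t) fmmulE.
Qed.

Lemma free_act_x j phi : free_act (free_x j) phi = letter_act (inl j) phi.
Proof. by rewrite free_actU scale1r fmuE. Qed.

Lemma free_act_d j phi : free_act (free_d j) phi = letter_act (inr j) phi.
Proof. by rewrite free_actU scale1r fmuE. Qed.

Lemma free_act1 phi : free_act 1 phi = phi.
Proof. by rewrite free_actU scale1r -[one]/(fmone _) fmoneE. Qed.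

Lemma free_act_relator f phi : weyl_relators f -> free_act f phi = 0.
Proof.
move=> [i [j [] ->]];
  rewrite !(free_actD, free_actN, free_actM, free_act_x, free_act_d).
- by apply/eqP; rewrite subr_eq0; apply/eqP/funext => gam /=; rewrite addrAC.
- apply/eqP; rewrite subr_eq0; apply/eqP.
  have [-> //|neq_ij] := eqVneq i j; apply/funext => gam /=.
  rewrite [gam + delta_mx j 0 + _]addrAC !mderivD !mderivZ !scalerDr !scalerA.
  rewrite !mxE !eqxx (negPf neq_ij) eq_sym (negPf neq_ij) /= !addr0 !mulr1n.
  rewrite mderiv_comm -!addrA [in RHS]mulrC; congr (_ + _).
  exact: addrCA.
- have addE (p q : V) x : (p + q) x = p x + q x by [].
  have oppE (p : V) x : (- p) x = - p x by [].
  have zeroE x : (0 : V) x = 0 by [].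
  apply/funext => gam; rewrite !(addE, oppE, zeroE) /=.
  rewrite [gam - _ + _]addrAC opprD addrACA subrr addr0 -scalerBl !mxE eqxx /=.
  rewrite andbT; have [->|_] := eqVneq i j; last first.
    by rewrite free_act0 zeroE !subr0 subrr scale0r.
  by rewrite -[true%:R]/1 free_act1 !addrK addrAC subrr add0r scale1r subrr.
Qed.

Lemma weyl_act_pi (P : free_alg) phi :
  weyl_act (quot_pi weyl_relators P) phi = free_act P phi.
Proof.
apply/eqP; rewrite -subr_eq0 -free_actN -free_actD.
have [r Gr ->] := repr_quot weyl_relators P.
rewrite free_act_sum big_seq big1 // => p /Gr Gp.
rewrite !free_actM (free_act_relator _ Gp).
by rewrite /free_act big1 // => t _; rewrite word_act0 scaler0.
Qed.

End Weyl.

Definition weyl_of_poly (K : comNzRingType) (n : nat) (p : {mpoly K[n]}) :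
    weyl K n :=
  \sum_(m <- msupp p) weyl_c n p@_m * \prod_(j < n) weyl_d K j ^+ m j.

Section Hypergeometric.
Variables (R : realType) (d n : nat).
Local Notation C := R[i].
Local Notation poly := {mpoly C[n]}.

Definition toC (m : nat) (u : 'cV[int]_m) : 'cV[C]_m := map_mx intr u.

Definition latticeL (A : 'M[int]_(d, n)) : set 'cV[int]_n :=
  [set u | A *m u = 0].

Definition exponent_lattice (A : 'M[int]_(d, n)) (beta : 'cV[C]_d)
    (Lam : set 'cV[C]_n) : Prop :=
  exists2 lam : 'cV[C]_n, map_mx intr A *m lam = beta &
    Lam = [set lam + toC u | u in latticeL A].

Definition lattice_tilde (Lam : set 'cV[C]_n) : set 'cV[C]_n :=
  [set gam + toC z | gam in Lam & z in setT].

(* The order of R[i] is partial: 0 <= z means that z is real and nonnegative. *)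
(* Below, [dotw w] is only compared on differences of points of one exponent  *)
(* lattice, which are integer vectors, so these values are always real.       *)
Definition dotw (w : 'cV[R]_n) (v : 'cV[C]_n) : C :=
  \sum_(j < n) (w j 0)%:C%C * v j 0.

Definition L_generic (A : 'M[int]_(d, n)) (w : 'cV[R]_n) : Prop :=
  forall u, latticeL A u -> u != 0 -> dotw w (toC u) != 0.

Definition lew (w : 'cV[R]_n) (gam gam' : 'cV[C]_n) : Prop :=
  0 <= dotw w (gam' - gam).

Definition ltw (w : 'cV[R]_n) (gam gam' : 'cV[C]_n) : Prop :=
  lew w gam gam' /\ gam <> gam'.

Definition wmins (w : 'cV[R]_n) (X : set 'cV[C]_n) : set 'cV[C]_n :=
  [set gam | X gam /\ forall gam', X gam' -> lew w gam gam'].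

(* The value 0 is junk, taken when X has no minimum. *)
Definition wmin (w : 'cV[R]_n) (X : set 'cV[C]_n) : 'cV[C]_n :=
  xget 0 (wmins w X).

Definition nsupp (gam : 'cV[C]_n) : {set 'I_n} :=
  [set j | `[< exists k : nat, gam j 0 = - (k.+1)%:R >]].

Definition Lam_ (Lam : set 'cV[C]_n) (I : {set 'I_n}) : set 'cV[C]_n :=
  [set gam | Lam gam /\ nsupp gam = I].

Definition NS (Lam : set 'cV[C]_n) : set {set 'I_n} :=
  [set I | Lam_ Lam I !=set0].

Definition Bw (w : 'cV[R]_n) (Lam : set 'cV[C]_n) : set {set 'I_n} :=
  [set I | NS Lam I /\ exists2 lam, Lam lam &
     exists b : R, forall gam, Lam_ Lam I gam -> b%:C%C <= dotw w (gam - lam)].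

Definition vexp (w : 'cV[R]_n) (Lam : set 'cV[C]_n) (I : {set 'I_n}) :=
  wmin w (Lam_ Lam I).

Definition Aw (w : 'cV[R]_n) (Lam : set 'cV[C]_n) : set {set 'I_n} :=
  [set I | NS Lam I /\ forall J, NS Lam J -> J \subset I -> Bw w Lam J].

Definition Aw_lt (w : 'cV[R]_n) (Lam : set 'cV[C]_n) (K : {set 'I_n}) :
    set {set 'I_n} :=
  [set J | Aw w Lam J /\ ltw w (vexp w Lam J) (vexp w Lam K)].

(* In C[d_x] and in S = C[d_y] alike, the variable 'X_j stands for the j-th   *)
(* partial derivative.                                                        *)
Definition upos (u : 'cV[int]_n) : 'X_{1..n} :=
  [multinom absz (Num.max (u j 0) 0)%R | j < n].

Definition toric_ideal (A : 'M[int]_(d, n)) : set poly :=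
  ideal_span [set ('X_[upos u] - 'X_[upos (- u)] : poly) | u in latticeL A].

Definition euler_op (A : 'M[int]_(d, n)) (beta : 'cV[C]_d) (i : 'I_d) :
    weyl C n :=
  \sum_(j < n) (weyl_x C j * weyl_d C j) *~ A i j - weyl_c n (beta i 0).

Definition HA (A : 'M[int]_(d, n)) (beta : 'cV[C]_d) : set (weyl C n) :=
  ideal_add (ideal_span [set weyl_of_poly p | p in toric_ideal A])
            (ideal_span (range (euler_op A beta))).

Definition Supp (phi : logseries C n) : set 'cV[C]_n :=
  [set gam | phi gam <> 0].

Definition Flog (X : set 'cV[C]_n) : set (logseries C n) :=
  [set phi | Supp phi `<=` X].

Definition Soldir (A : 'M[int]_(d, n)) (beta : 'cV[C]_d) (w : 'cV[R]_n)
    (Lam : set 'cV[C]_n) : set (logseries C n) :=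
  [set phi | [/\ Flog (lattice_tilde Lam) phi,
                 Supp phi `<=` Lam,
                 forall P, HA A beta P -> weyl_act P phi = 0 &
                 phi = 0 \/ wmins w (Supp phi) !=set0]].

Definition lexp (w : 'cV[R]_n) (phi : logseries C n) : 'cV[C]_n :=
  wmin w (Supp phi).

Definition Rexp (A : 'M[int]_(d, n)) (beta : 'cV[C]_d) (w : 'cV[R]_n)
    (Lam : set 'cV[C]_n) : set 'cV[C]_n :=
  [set lexp w phi | phi in [set phi | Soldir A beta w Lam phi /\ phi <> 0]].

Definition dact (f p : poly) : poly :=
  \sum_(m <- msupp f) f@_m *: mderivm m p.

Definition Ady (A : 'M[int]_(d, n)) (i : 'I_d) : poly :=
  \sum_(j < n) 'X_j *~ A i j.

Definition dset (I : {set 'I_n}) : poly := \prod_(j in I) 'X_j.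

(* Families indexed by NS Lam are given by functions on all subsets of [n];   *)
(* the values outside NS Lam are irrelevant.                                  *)
Definition Coeffdir (A : 'M[int]_(d, n)) (w : 'cV[R]_n) (Lam : set 'cV[C]_n) :
    set ({set 'I_n} -> poly) :=
  [set c | [/\ forall I, NS Lam I -> forall i, dact (Ady A i) (c I) = 0,
               forall I J, NS Lam I -> NS Lam J ->
                 dact (dset (J :\: I)) (c I) = dact (dset (I :\: J)) (c J) &
               forall I, NS Lam I -> ~ Aw w Lam I -> c I = 0]].

Definition Clt (A : 'M[int]_(d, n)) (w : 'cV[R]_n) (Lam : set 'cV[C]_n)
    (K : {set 'I_n}) : set poly :=
  [set c K | c in [set c | Coeffdir A w Lam c /\
                           forall J, Aw_lt w Lam K J -> c J = 0]].

Definition eA (A : 'M[int]_(d, n)) : set poly := ideal_span (range (Ady A)).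

Definition MLam (Lam : set 'cV[C]_n) : set poly :=
  ideal_span (dset @` NS Lam).

Definition Plt (w : 'cV[R]_n) (Lam : set 'cV[C]_n) (K : {set 'I_n}) : set poly :=
  ideal_span (dset @` ((NS Lam `\` Aw w Lam) `|` Aw_lt w Lam K)).

Definition Qlt (A : 'M[int]_(d, n)) (w : 'cV[R]_n) (Lam : set 'cV[C]_n)
    (K : {set 'I_n}) : set poly :=
  ideal_add (ideal_mul (eA A) (MLam Lam)) (Plt w Lam K).

Definition Solpoly (a : set poly) : set poly :=
  [set p | forall f, a f -> dact f p = 0].

Definition AnnS (V : set poly) : set poly :=
  [set f | forall p, V p -> dact f p = 0].
End Hypergeometric.

(* Main.v *)
From HB Require Import structures.
Require Import Defs.
From mathcomp Require Import all_boot all_order all_algebra.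
From mathcomp Require Import boolp classical_sets functions reals.
From mathcomp Require Import complex ring lra zify.
From mathcomp Require monalg.
From mathcomp Require Import ssrcomplements mpoly.
Set Implicit Arguments.
Unset Strict Implicit.
Unset Printing Implicit Defensive.
Import Order.TTheory GRing.Theory Num.Theory.
Local Open Scope classical_set_scope.
Local Open Scope ring_scope.

(** The proof combines a duality argument in C[y] with a Frobenius-type
description of the solutions of H_A(beta) supported in one exponent lattice.

Duality.  Evaluating f . q at the origin pairs polynomials f in S with
polynomials q in C[y], perfectly in each degree.  A system of equations
F_x . q = p_x with finitely many homogeneous F_x therefore has a polynomial
solution q as soon as every syzygy of the F_x kills the p_x: degrees bound the
unknown q, and what is left is finite-dimensional linear algebra
([homog_system]).  In other words C[y] behaves as an injective module for
homogeneous ideals.  Two consequences hold for an ideal Q with finitely many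
homogeneous generators and a homogeneous u: Ann(Sol(Q)) = Q ([AnnS_Solpoly]),
and Sol(Q : u) = u . Sol(Q) ([Solpoly_colon]).

Coefficient families.  The compatibility relations between the components c_I
of a coefficient family are exactly what is needed to write c_I = d^I . q for
all I in NS(Lambda) with a single polynomial q ([monomial_lift]).  The
remaining conditions on the family then say that q is killed by e_A M and by
the monomials d^J whose component has to vanish, i.e. q lies in Sol(Q^{<K}).
Hence C^{<}_K = d^K . Sol(Q^{<K}) ([Clt_image]), which is Sol(Q^{<K} : d^K),
with annihilator Q^{<K} : d^K.

Solutions.  Applying a monomial in the partial derivatives to
x^gamma p(log x) multiplies p by a product of linear factors
gamma_j - k + d_{y_j}.  Such a factor acts bijectively on C[y] unless
gamma_j = k, in which case it is d_{y_j}; this happens once for each coordinate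
that passes from nonnegative to negative integers.  The invertible factors can
be normalised away by units depending on gamma only, a polynomial version of
the Gamma factors of the Frobenius method ([falling_cross]).  After this
normalisation the binomials of I_A say that the coefficient depends only on
nsupp(gamma) and satisfies the compatibility relations, while the Euler
operators say that it is killed by e_A ([HA_frobeniusP]).  So solutions
supported in Lambda correspond to families (c_I), and the support is the union
of the Lambda_I with c_I <> 0.

Initial exponents.  By Dickson's lemma a weight bounded below on Lambda_I
attains its minimum there ([Bw_vexp]).  A solution whose support has a minimum
has c_I = 0 outside B_w; since c_I = d^{I \ J} . c_J for J in I, it even has
c_I = 0 outside A_w.  Its initial exponent is then v_K for the unique K
with c_K <> 0 and c_J = 0 for all v_J < v_K ([coeff_of_Rexp]), and conversely
every such family gives a solution with initial exponent v_K
([Rexp_of_coeff]). *)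

(** * The action of S on C[y] *)
Section MonomialExtension.
Variables (C : comNzRingType) (n : nat) (V : lmodType C) (G : 'X_{1..n} -> V).
Implicit Types p q : {mpoly C[n]}.

(** The linear extension of a function on monomials: both the action of S on
C[y] and that of C[d_x] on logarithmic series are of this form. *)
Definition mono_ext p : V := \sum_(m <- msupp p) p@_m *: G m.

Lemma mono_extwE k p : (msize p <= k)%N ->
  mono_ext p = \sum_(m : 'X_{1..n < k}) p@_m *: G m.
Proof.
move=> le_pk; rewrite /mono_ext (big_mksub 'X_{1..n < k}) /=; first last.
- by move=> m /msize_mdeg_lt/leq_trans; apply.
- exact: msupp_uniq.
by rewrite big_rmcond //= => m /memN_msupp_eq0 ->; rewrite scale0r.
Qed.

Lemma mono_extD p q : mono_ext (p + q) = mono_ext p + mono_ext q.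
Proof.
pose k := maxn (msize p) (msize q).
rewrite !(@mono_extwE k) ?leq_maxl ?leq_maxr ?msizeD_le // -big_split /=.
by apply: eq_bigr => m _; rewrite mcoeffD scalerDl.
Qed.

Lemma mono_extZ c p : mono_ext (c *: p) = c *: mono_ext p.
Proof.
rewrite !(@mono_extwE (msize p)) ?mmeasureZ_le // scaler_sumr.
by apply: eq_bigr => m _; rewrite mcoeffZ scalerA.
Qed.

Lemma mono_ext0 : mono_ext 0 = 0.
Proof. by rewrite /mono_ext msupp0 big_nil. Qed.

Lemma mono_extX m : mono_ext 'X_[m] = G m.
Proof. by rewrite /mono_ext msuppX big_seq1 mcoeffX eqxx scale1r. Qed.

End MonomialExtension.

Section DiffAction.
Variables (R : realType) (n : nat).
Local Notation C := R[i].
Local Notation poly := {mpoly C[n]}.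
Implicit Types (f g p q : poly) (m : 'X_{1..n}).

Lemma dactwE k f p : (msize f <= k)%N ->
  dact f p = \sum_(m : 'X_{1..n < k}) f@_m *: p^`M[m].
Proof. exact: mono_extwE. Qed.

Lemma dact_is_linear f : linear (dact f).
Proof.
move=> c p q; rewrite /dact scaler_sumr -big_split /=.
apply: eq_bigr => m _.
by rewrite mderivmD mderivmZ scalerDr !scalerA mulrC.
Qed.
HB.instance Definition _ f :=
  GRing.isLinear.Build C poly poly _ (dact f) (dact_is_linear f).

Lemma dactDl f g p : dact (f + g) p = dact f p + dact g p.
Proof. exact: mono_extD. Qed.

Lemma dact0l p : dact 0 p = 0.
Proof. exact: mono_ext0. Qed.

Lemma dactZl c f p : dact (c *: f) p = c *: dact f p.
Proof. exact: mono_extZ. Qed.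

Lemma dactNl f p : dact (- f) p = - dact f p.
Proof. by rewrite -scaleN1r dactZl scaleN1r. Qed.

Lemma dact_suml (I : Type) (r : seq I) (P : pred I) (F : I -> poly) p :
  dact (\sum_(i <- r | P i) F i) p = \sum_(i <- r | P i) dact (F i) p.
Proof.
by elim/big_rec2: _ => [|i f q _ <-]; rewrite ?dact0l ?dactDl.
Qed.

Lemma dactX m p : dact 'X_[m] p = p^`M[m].
Proof. exact: mono_extX. Qed.

Lemma dactC c p : dact c%:MP p = c *: p.
Proof. by rewrite -[c%:MP]mulr1 mul_mpolyC dactZl -mpolyX0 dactX mderivm0m. Qed.

Lemma dact1 p : dact 1 p = p.
Proof. by rewrite -mpolyX0 dactX mderivm0m. Qed.

(** C[y] is an S-module: on monomials this is the composition rule for iterated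
partial derivatives. *)
Lemma dactM f g p : dact (f * g) p = dact f (dact g p).
Proof.
have monoM m h q : dact ('X_[m] * h) q = dact 'X_[m] (dact h q).
  rewrite {1}[h]mpolyE mulr_sumr dact_suml [dact h q]/dact linear_sum.
  apply: eq_bigr => m' _.
  by rewrite -scalerAr dactZl linearZ /= -mpolyXD !dactX addmC mderivmDm.
rewrite {1}[f]mpolyE mulr_suml dact_suml [RHS]/dact; apply: eq_bigr => m _.
by rewrite -scalerAl dactZl monoM dactX.
Qed.

Lemma dactMC f g p : dact f (dact g p) = dact g (dact f p).
Proof. by rewrite -!dactM mulrC. Qed.

Lemma mcoeff_dact_le f p m k : (msize p <= mdeg m + k)%N ->
  (forall m', (mdeg m' < k)%N -> f@_m' = 0) -> (dact f p)@_m = 0.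
Proof.
move=> le_p f_lo; rewrite /dact raddf_sum big1 //= => m' _.
rewrite mcoeffZ mcoeff_mderivm.
have [/f_lo ->|le_k] := ltnP (mdeg m') k; first by rewrite mul0r.
rewrite [p@__]memN_msupp_eq0 ?mul0rn ?mulr0 //; apply: msize_mdeg_ge.
by rewrite mdegD (leq_trans le_p) // addnC leq_add2r.
Qed.

Lemma mcoeff0_mderivm m p : (p^`M[m])@_0 = p@_m *+ \prod_(i < n) (m i)`!.
Proof.
rewrite mcoeff_mderivm addm0; congr (_ *+ _).
by apply: eq_bigr => i _; rewrite ffactnn.
Qed.

(** The Taylor coefficient at m is, up to the nonzero factor m!, the value at the
origin of the m-th derivative; polynomials are compared through these values. *)
Lemma mcoeff_dactX0 m p : (dact 'X_[m] p)@_0 = 0 -> p@_m = 0.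
Proof.
rewrite dactX mcoeff0_mderivm => /eqP; rewrite mulrn_eq0 => /orP[|/eqP //].
by rewrite -leqn0 leqNgt prodn_gt0 // => i; apply: fact_gt0.
Qed.

Lemma msize_dact_lt f p : f@_0 = 0 -> p != 0 -> (msize (dact f p) < msize p)%N.
Proof.
move=> f0 p0; rewrite (mpolySpred _ p0) ltnS.
rewrite msizeE; apply/bigmax_leqP_seq => m /=; rewrite mcoeff_msupp => nz _.
rewrite ltnNge; apply: contra_neqN nz => le_m.
apply: (@mcoeff_dact_le _ _ _ 1); first by rewrite addn1 (mpolySpred _ p0) ltnS.
by move=> m'; rewrite ltnS leqn0 mdeg_eq0 => /eqP ->.
Qed.

Lemma dact_const_sub f p : dact f p = f@_0 *: p + dact (f - (f@_0)%:MP) p.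
Proof. by rewrite dactDl dactNl dactC addrC subrK. Qed.

Lemma mcoeff0_subC f : (f - (f@_0)%:MP)@_0 = 0.
Proof. by rewrite mcoeffB mcoeffC eqxx mulr1 subrr. Qed.

(** An operator with nonzero constant term is a nonzero scalar plus a part that
strictly lowers degrees, hence it is bijective on C[y]: its inverse is a
locally finite power series in the derivatives. *)
Lemma dact_unit_inj f : f@_0 != 0 -> injective (dact f).
Proof.
move=> f0; apply: raddf_inj => p /= /eqP; rewrite dact_const_sub addr_eq0 => /eqP fp.
apply/eqP; apply: contraT => p0.
have := msize_dact_lt (mcoeff0_subC f) p0.
have -> : dact (f - (f@_0)%:MP) p = - f@_0 *: p by rewrite scaleNr fp opprK.
by rewrite mmeasureZ ?oppr_eq0 // ltnn.
Qed.

Lemma dact_unit_surj f p : f@_0 != 0 -> exists q, dact f q = p.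
Proof.
move=> f0; have [k] := ubnP (msize p); elim: k p => // k IH p; rewrite ltnS => le_p.
have [->|p0] := eqVneq p 0; first by exists 0; rewrite linear0.
have [|q fq] := IH (- dact (f - (f@_0)%:MP) ((f@_0)^-1 *: p)).
  rewrite mmeasureN linearZ /=; apply: leq_ltn_trans (mmeasureZ_le _ _ _) _.
  exact: leq_trans (msize_dact_lt (mcoeff0_subC f) p0) le_p.
exists ((f@_0)^-1 *: p + q); rewrite linearD /= fq.
by rewrite dact_const_sub scalerA divff // scale1r addrK.
Qed.

End DiffAction.

(** * Finite moment problems and Macaulay duality *)
Section Macaulay.
Variables (R : realType) (n : nat).
Local Notation C := R[i].
Local Notation poly := {mpoly C[n]}.
Implicit Types (f g p q : poly) (m : 'X_{1..n}).

(** Solvability of a finite linear system, in terms of the pairing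
(f, q) |-> (f . q)(0): in the monomial bases its matrix is diagonal with the
nonzero entries m!, so a linear relation between the forms (h_x, -) on
polynomials of degree below N is a relation between the h_x themselves. *)
Lemma moment_problem (X : finType) (h : X -> poly) (b : X -> C) (N : nat) :
  (forall x, msize (h x) <= N)%N ->
  (forall a : X -> C, \sum_x a x *: h x = 0 -> \sum_x a x * b x = 0) ->
  exists2 q : poly, (msize q <= N)%N & forall x, (dact (h x) q)@_0 = b x.
Proof.
move=> le_hN rel_b.
pose mon (j : 'I_#|{: 'X_{1..n < N}}|) := (enum_val j : 'X_{1..n < N}) : 'X_{1..n}.
pose fac (m : 'X_{1..n}) : C := (\prod_(i < n) (m i)`!)%:R.
pose M : 'M[C]_(#|{: 'X_{1..n < N}}|, #|X|) :=
  \matrix_(j, i) ((h (enum_val i))@_(mon j) * fac (mon j)).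
pose bv : 'rV[C]_#|X| := \row_i b (enum_val i).
have fac_neq0 m : fac m != 0.
  by rewrite pnatr_eq0 -lt0n prodn_gt0 // => i; apply: fact_gt0.
have /submxP[v bvE] : (bv <= M)%MS.
  rewrite submxE; apply/eqP; have := mulmx_coker M.
  move: (cokermx M) => coker /matrixP Mk; apply/matrixP => i k; rewrite ord1 !mxE.
  pose a x := coker (enum_rank x) k.
  transitivity (\sum_x a x * b x).
    rewrite (reindex_onto (@enum_val X predT) enum_rank) /=; last first.
      by move=> x _; rewrite enum_rankK.
    apply: eq_big => [j|j _]; first by rewrite enum_valK eqxx.
    by rewrite !mxE /a enum_valK mulrC.
  apply: rel_b; apply/mpolyP => m; rewrite raddf_sum mcoeff0 /=.
  have [lt_m|le_m] := ltnP (mdeg m) N; last first.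
    rewrite big1 // => x _; rewrite mcoeffZ memN_msupp_eq0 ?mulr0 //.
    by apply: msize_mdeg_ge; apply: leq_trans le_m.
  have := Mk (enum_rank (BMultinom lt_m)) k; rewrite !mxE => Mk0.
  apply: (mulIf (fac_neq0 m)); rewrite mul0r mulr_suml -[RHS]Mk0.
  rewrite [RHS](reindex_onto enum_rank (@enum_val X predT)) /=; last first.
    by move=> x _; rewrite enum_valK.
  apply: eq_big => [x|x _]; first by rewrite enum_rankK eqxx.
  by rewrite !mxE enum_rankK mcoeffZ /mon enum_rankK /= /a [RHS]mulrC mulrA.
pose q : poly := \sum_(m : 'X_{1..n < N}) v 0 (enum_rank m) *: 'X_[m].
have qE (j : 'I_#|{: 'X_{1..n < N}}|) : q@_(mon j) = v 0 j.
  rewrite raddf_sum (bigD1 (enum_val j)) //= mcoeffZ mcoeffX eqxx mulr1.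
  rewrite enum_valK big1 ?addr0 // => m neq_m; rewrite mcoeffZ mcoeffX.
  by rewrite -[bmnm m == _]/(m == _) (negPf neq_m) mulr0.
exists q.
  apply: leq_trans (mmeasure_sum _ _ _ _) _; apply/bigmax_leqP => m _.
  by apply: leq_trans (mmeasureZ_le _ _ _) _; rewrite mmeasureX bmdeg.
move=> x; have /rowP/(_ (enum_rank x)) := bvE; rewrite !mxE enum_rankK => ->.
rewrite (dactwE _ (le_hN x)) raddf_sum /=.
rewrite (reindex_onto (@enum_val {: 'X_{1..n < N}} predT) enum_rank) /=; last first.
  by move=> m _; rewrite enum_rankK.
apply: eq_big => [j|j _]; first by rewrite enum_valK eqxx.
rewrite mcoeffZ mcoeff0_mderivm [X in _ * (X *+ _)]qE !mxE enum_rankK.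
by rewrite -mulr_natr mulrCA.
Qed.

(** C[y] is injective relative to homogeneous ideals.  The equation
F_x . q = p_x is replaced by its Taylor coefficients, i.e. by the conditions
(X^m F_x . q)(0) = (X^m . p_x)(0).  Homogeneity lets all of them be cut off at
one common degree N: beyond it, both F_x . q and p_x vanish.  The extra
inhomogeneous functional f serves to separate f from the ideal of the F_x. *)
Lemma homog_system (X : finType) (F : X -> poly) (e : X -> nat) (p : X -> poly)
    (f : poly) (a : C) :
  (forall x, F x \is (e x).-homog) ->
  (forall (g : X -> poly) (c : C), \sum_x g x * F x + c *: f = 0 ->
     \sum_x (dact (g x) (p x))@_0 + c * a = 0) ->
  exists2 q, (forall x, dact (F x) q = p x) & (dact f q)@_0 = a.
Proof.
move=> homF rel.
(* N bounds the degree of f and, for each x, the degree of p_x after a shift by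
   the degree of F_x. *)
pose N := (msize f + \max_x e x + \max_x msize (p x)).+1.
have leN x : (msize (p x) + e x < N)%N.
  rewrite ltnS addnC; apply: leq_add; last exact: (leq_bigmax (F := fun y => msize (p y))).
  by apply: leq_trans (leq_addl _ _); apply: leq_bigmax.
pose Y := option (X * 'X_{1..n < N}).
pose h (y : Y) : poly := if y is Some (x, m) then
  if (mdeg m + e x < N)%N then 'X_[m] * F x else 0 else f.
pose b (y : Y) : C := if y is Some (x, m) then
  if (mdeg m + e x < N)%N then (dact 'X_[m] (p x))@_0 else 0 else a.
have sumY (V : nmodType) (G : Y -> V) :
    \sum_y G y = \sum_x \sum_(m : 'X_{1..n < N}) G (Some (x, m)) + G None.
  rewrite (bigD1 None) //= addrC; congr (_ + _).
  rewrite pair_bigA /= (reindex_omap Some id) //=; last by case.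
  by apply: eq_big => [[x m]|[x m] _] //=; rewrite eqxx.
have [||q le_qN hq] := @moment_problem Y h b N.
- case=> [[x m]|] /=; last by rewrite /N -addnA ltnW // ltnS leq_addr.
  case: ifP => [lt_N|_]; last by rewrite mmeasure0.
  apply/bigmax_leqP_seq => m' m'in _; apply: leq_trans lt_N; rewrite ltnS.
  have /dhomogP -> // : 'X_[m] * F x \is (mdeg m + e x).-homog.
  by apply: dhomogM => //; rewrite dhomogX.
- move=> c; rewrite !sumY /= => rel0.
  pose g x := \sum_(m : 'X_{1..n < N} | (mdeg m + e x < N)%N) c (Some (x, m)) *: 'X_[m].
  rewrite -[RHS](rel g (c None)) /=.
    congr (_ + _); apply: eq_bigr => x _; rewrite dact_suml raddf_sum /= [RHS]big_mkcond.
    by apply: eq_bigr => m _; case: ifP => _; rewrite ?mulr0 // dactZl mcoeffZ.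
  rewrite -[RHS]rel0; congr (_ + _); apply: eq_bigr => x _.
  rewrite mulr_suml big_mkcond; apply: eq_bigr => m _.
  by case: ifP; rewrite ?scaler0 // scalerAl.
exists q; last exact: (hq None).
move=> x; apply/mpolyP => m.
have lowF m' : (mdeg m' < e x)%N -> (F x)@_m' = 0.
  move=> lt_m'; apply: dhomog_nemf_coeff (homF x) _; by rewrite neq_ltn lt_m'.
have [lt_N|le_N] := ltnP (mdeg m + e x) N; last first.
  rewrite (mcoeff_dact_le _ lowF) ?(leq_trans le_qN) // memN_msupp_eq0 //.
  apply: msize_mdeg_ge; rewrite -(leq_add2r (e x)).
  exact: leq_trans (ltnW (leN x)) le_N.
have lt_m : (mdeg m < N)%N by apply: leq_ltn_trans lt_N; apply: leq_addr.
apply/eqP; rewrite -subr_eq0 -mcoeffB; apply/eqP/mcoeff_dactX0.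
rewrite linearB mcoeffB /= -dactM.
by have := hq (Some (x, BMultinom lt_m)); rewrite /= lt_N => ->; rewrite subrr.
Qed.

End Macaulay.

(** * Ideals and their polynomial solutions *)
Section Ideals.
Variable T : pzRingType.
Implicit Types (G : set T) (f g : T).

Lemma ideal_span0 G : ideal_span G 0.
Proof. by exists [::] => //; rewrite big_nil. Qed.

Lemma ideal_spanD G f g :
  ideal_span G f -> ideal_span G g -> ideal_span G (f + g).
Proof.
move=> [s Gs ->] [t Gt ->]; exists (s ++ t); last by rewrite big_cat.
by move=> p; rewrite mem_cat => /orP[/Gs|/Gt].
Qed.

Lemma ideal_spanM G h f : ideal_span G f -> ideal_span G (h * f).
Proof.
move=> [s Gs ->]; exists [seq (h * p.1, p.2) | p <- s].
  by move=> _ /mapP[p /Gs Gp ->].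
by rewrite big_map mulr_sumr; apply: eq_bigr => p _; rewrite mulrA.
Qed.

Lemma ideal_span_gen G g : G g -> ideal_span G g.
Proof.
move=> Gg; exists [:: (1, g)]; last by rewrite big_seq1 mul1r.
by move=> p; rewrite inE => /eqP ->.
Qed.

Lemma ideal_span_sum (I : finType) G (F : I -> T) :
  (forall i, ideal_span G (F i)) -> ideal_span G (\sum_i F i).
Proof.
move=> GF; apply: (big_ind (ideal_span G)) => //; first exact: ideal_span0.
exact: ideal_spanD.
Qed.

Lemma ideal_span_min G (a : set T) :
  a 0 -> (forall f g, a f -> a g -> a (f + g)) -> (forall h f, a f -> a (h * f)) ->
  G `<=` a -> ideal_span G `<=` a.
Proof.
move=> a0 aD aM Ga _ [s Gs ->]; rewrite big_seq.
by apply: (big_ind a) => // p /Gs/Ga/aM.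
Qed.

Lemma ideal_span_le G G' : G `<=` ideal_span G' -> ideal_span G `<=` ideal_span G'.
Proof.
by apply: ideal_span_min => [|f g|h f];
  [apply: ideal_span0|apply: ideal_spanD|apply: ideal_spanM].
Qed.

Lemma ideal_span_range (X : finType) (F : X -> T) f :
  ideal_span (range F) f <-> exists g : X -> T, f = \sum_x g x * F x.
Proof.
split=> [|[g ->]]; last first.
  apply: ideal_span_sum => x; apply/ideal_spanM/ideal_span_gen; by exists x.
move: f; apply: ideal_span_min.
- by exists (fun=> 0); rewrite big1 // => x; rewrite mul0r.
- move=> _ _ [g ->] [h ->]; exists (fun x => g x + h x).
  by rewrite -big_split; apply: eq_bigr => x _; rewrite mulrDl.
- move=> h _ [g ->]; exists (fun x => h * g x).
  by rewrite mulr_sumr; apply: eq_bigr => x _; rewrite mulrA.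
move=> _ [x _ <-]; exists (fun y => (y == x)%:R); rewrite (bigD1 x) //= eqxx mul1r.
by rewrite big1 ?addr0 // => y /negPf ->; rewrite mul0r.
Qed.

Lemma ideal_add_span G G' :
  ideal_add (ideal_span G) (ideal_span G') = ideal_span (G `|` G').
Proof.
apply/seteqP; split=> [_ [f [g [Gf G'g ->]]]|].
  apply: ideal_spanD; [move: Gf|move: G'g]; apply: ideal_span_le => h Gh;
    by apply: ideal_span_gen; first [left; exact: Gh | right; exact: Gh].
apply: ideal_span_min.
- by exists 0, 0; rewrite addr0; split=> //; apply: ideal_span0.
- move=> _ _ [f [g [Gf Gg ->]]] [f' [g' [Gf' Gg' ->]]].
  by exists (f + f'), (g + g'); rewrite addrACA; split=> //; apply: ideal_spanD.
- move=> h _ [f [g [Gf Gg ->]]].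
  by exists (h * f), (h * g); rewrite mulrDr; split=> //; apply: ideal_spanM.
move=> f [Gf|Gf]; [exists f, 0|exists 0, f]; rewrite ?addr0 ?add0r; split=> //;
  by [apply: ideal_span0|apply: ideal_span_gen].
Qed.

End Ideals.

Lemma ideal_mul_span (T : comPzRingType) (G G' : set T) :
  ideal_mul (ideal_span G) (ideal_span G') =
  ideal_span [set f * g | f in G & g in G'].
Proof.
apply/seteqP; split; apply: ideal_span_le; last first.
  move=> _ [f Gf [g Gg <-]]; apply: ideal_span_gen.
  by exists f, g; split=> //; apply: ideal_span_gen.
set b := ideal_span [set _ | _ in G & _ in _] => _ [f [g [Gf G'g ->]]].
have bM h k : b k -> b (h * k) by exact: ideal_spanM.
have bD h k : b h -> b k -> b (h + k) by exact: ideal_spanD.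
have b0 : b 0 by exact: ideal_span0.
suff sub : ideal_span G `<=` [set f | b (f * g)] by exact: (sub f Gf).
apply: ideal_span_min => /=.
- by rewrite mul0r.
- by move=> h k; rewrite mulrDl; apply: bD.
- by move=> h k; rewrite -mulrA; apply: bM.
move=> {Gf}f Gf /=; suff sub : ideal_span G' `<=` [set g | b (f * g)] by exact: (sub g G'g).
apply: ideal_span_min => /=.
- by rewrite mulr0.
- by move=> h k; rewrite mulrDr; apply: bD.
- by move=> h k; rewrite mulrCA; apply: bM.
by move=> {G'g}g G'g; apply: ideal_span_gen; exists f => //; exists g.
Qed.

Section Duality.
Variables (R : realType) (n : nat).
Local Notation C := R[i].
Local Notation poly := {mpoly C[n]}.
Implicit Types (f g p q : poly) (m : 'X_{1..n}).

Lemma Solpoly_span (G : set poly) p :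
  Solpoly (ideal_span G) p <-> forall g, G g -> dact g p = 0.
Proof.
split=> [sol g Gg|sol]; first exact/sol/ideal_span_gen.
apply: ideal_span_min => [|f g|h f|//] /=; first by rewrite dact0l.
  by rewrite dactDl => -> ->; rewrite addr0.
by rewrite dactM => ->; rewrite linear0.
Qed.

Section HomogFamily.
Variables (X : finType) (F : X -> poly) (e : X -> nat).
Hypothesis homF : forall x, F x \is (e x).-homog.
Local Notation FI := (ideal_span (range F)).

(** If f is not in the ideal, the system F_x . q = 0, (f . q)(0) = 1 has no
obstruction, and its solution q shows that f does not annihilate Sol. *)
Lemma AnnS_Solpoly : AnnS (Solpoly FI) = FI.
Proof.
apply/seteqP; split=> [f annf|f If p]; last by apply.
apply: contrapT => notIf.
have [||q Fq fq] := @homog_system _ _ X F e (fun=> 0) f 1 => //.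
  move=> g c gF; rewrite big1 ?add0r ?mulr1; last by move=> x; rewrite linear0 mcoeff0.
  have [//|c0] := eqVneq c 0; case: notIf.
  have -> : f = - c^-1 *: \sum_x g x * F x.
    rewrite (_ : \sum_x _ = - (c *: f)).
      by rewrite scaleNr scalerN opprK scalerA mulVf // scale1r.
    by apply/eqP; rewrite -addr_eq0 gF.
  rewrite -mul_mpolyC; apply: ideal_spanM; apply/ideal_span_range.
  by exists g.
have := annf q; rewrite (Solpoly_span (range F)) => f0.
move/eqP: fq; rewrite f0 ?mcoeff0 1?eq_sym ?oner_eq0 //.
by move=> _ [x _ <-].
Qed.

(** To divide a solution p of the colon ideal by u, solve u . q = p together
with F_x . q = 0: in a syzygy the coefficient of u lies in the colon ideal,
so it kills p. *)
Lemma Solpoly_colon u k : u \is k.-homog ->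
  Solpoly (colon FI u) = [set dact u q | q in Solpoly FI].
Proof.
move=> homu; apply/seteqP; split=> [p solp|_ [q solq <-] f Iuf]; last first.
  by rewrite -dactM; apply: solq.
pose F' (y : option X) := if y is Some x then F x else u.
have [||q Fq _] := @homog_system _ _ (option X) F'
  (fun y => if y is Some x then e x else k) (fun y => if y is None then p else 0) 0 0.
- by case.
- move=> g c; rewrite scaler0 addr0 mulr0 addr0 (bigD1 None) //= => gF.
  rewrite (bigD1 None) //= big1 ?addr0; last first.
    by case=> [x|] //= _; rewrite linear0 mcoeff0.
  rewrite solp ?mcoeff0 //= /colon /=.
  rewrite -[_ * u]opprK; move/eqP: gF; rewrite addrC addr_eq0 => /eqP <-.
  rewrite -mulN1r; apply: ideal_spanM; apply: (big_ind FI) => [|f h|[x|] //= _].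
  + exact: ideal_span0.
  + exact: ideal_spanD.
  by apply/ideal_spanM/ideal_span_gen; exists x.
exists q; last exact: (Fq None).
by apply/Solpoly_span => _ [x _ <-]; apply: (Fq (Some x)).
Qed.

End HomogFamily.

Lemma dsetE (I : {set 'I_n}) : dset R I = 'X_[mesym1 I].
Proof.
rewrite /dset mpolyXE_id big_mkcond; apply: eq_bigr => j _.
by rewrite mnmE; case: ifP => _; rewrite ?expr1 ?expr0.
Qed.

Lemma dset_mulD (I J : {set 'I_n}) :
  dset R (J :\: I) * dset R I = dset R (I :|: J).
Proof.
rewrite !dsetE -mpolyXD; congr 'X_[_]; apply/mnmP => j.
by rewrite mnmDE !mnmE !inE; case: (j \in I); case: (j \in J).
Qed.

(** Gluing: the coefficient of q at an exponent m is dictated by any c_I with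
I <= m, and compatibility says that all choices of I agree.  Exponents above no
I in U get the coefficient 0. *)
Lemma monomial_lift (U : set {set 'I_n}) (c : {set 'I_n} -> poly) :
  (forall I J, U I -> U J ->
     dact (dset R (J :\: I)) (c I) = dact (dset R (I :\: J)) (c J)) ->
  exists q, forall I, U I -> dact (dset R I) q = c I.
Proof.
move=> compat; pose ev m p := (dact 'X_[m] p)@_0.
pose P m (I : {set 'I_n}) := `[< U I >] && (mesym1 I <= m)%MM.
pose E m := if [pick J | P m J] is Some J then
  ev (m - mesym1 J)%MM (c J) / (\prod_(i < n) (m i)`!)%:R else 0.
(* m exceeds m - I in degree by at most n, hence the summand n. *)
pose N := (\max_I msize (c I) + n).+1.
pose q : poly := \sum_(m : 'X_{1..n < N}) E m *: 'X_[m].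
have evE m p : ev m p = p@_m * (\prod_(i < n) (m i)`!)%:R.
  by rewrite /ev dactX mcoeff0_mderivm mulr_natr.
have fac_neq0 m : (\prod_(i < n) (m i)`!)%:R != 0 :> C.
  by rewrite pnatr_eq0 -lt0n prodn_gt0 // => i; apply: fact_gt0.
have ev0 m I : (mesym1 I <= m)%MM -> (N <= mdeg m)%N -> ev (m - mesym1 I)%MM (c I) = 0.
  move=> le_Im le_Nm; rewrite evE memN_msupp_eq0 ?mul0r //; apply: msize_mdeg_ge.
  apply: leq_trans (leq_bigmax (F := fun I => msize (c I)) I) _.
  rewrite -(leq_add2r n); apply: leq_trans (ltnW le_Nm) _.
  rewrite -{1}(submK le_Im) mdegD leq_add2l mdeg_mesym1.
  by rewrite -[X in (_ <= X)%N]card_ord max_card.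
have qE m : q@_m = E m.
  have [lt_m|le_m] := ltnP (mdeg m) N; first exact: mcoeff_mpoly.
  rewrite /q raddf_sum big1 /=.
    rewrite /E; case: pickP => // I /andP[_ le_Im].
    by rewrite ev0 // mul0r.
  move=> m' _; rewrite mcoeffZ mcoeffX; case: eqP => [mm'|]; rewrite ?mulr0 //.
  by have := bmdeg m'; rewrite mm' ltnNge le_m.
exists q => I UI; apply/mpolyP => m; apply/eqP; rewrite -subr_eq0 -mcoeffB.
apply/eqP/mcoeff_dactX0; rewrite linearB mcoeffB /=.
apply/eqP; rewrite subr_eq0 -dactM dsetE -mpolyXD.
apply/eqP; rewrite -/(ev _ _) -[RHS]/(ev m (c I)) evE qE /E.
case: pickP => [J /andP[/asboolP UJ le_J]|/(_ I)]; last first.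
  by rewrite /P (asboolT UI) lem_addl.
(* The exponent of d^I . q at m lies above both I and J; the compatibility of c_I
   and c_J is used at what remains of it after removing their union. *)
rewrite divfK //; have /(congr1 (ev (m - mesym1 (J :\: I))%MM)) := compat I J UI UJ.
rewrite /ev -!dactM !dsetE -!mpolyXD => evIJ.
have le_JI : forall j, ((j \in J) <= m j + (j \in I))%N.
  by move=> j; have /mnm_lepP/(_ j) := le_J; rewrite mnmDE !mnmE.
transitivity (dact 'X_[(m - mesym1 (J :\: I) + mesym1 (I :\: J))] (c J))@_0.
  congr (dact 'X_[_] _)@_0; apply/mnmP => j; move: (le_JI j).
  rewrite !(mnmDE, mnmBE, mnmE) !inE.
  by case: (j \in I); case: (j \in J); rewrite /= ?addn0 ?subn0 ?addn1 ?subn1.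
rewrite -evIJ; congr (dact 'X_[_] _)@_0; apply/mnmP => j; move: (le_JI j).
rewrite !(mnmDE, mnmBE, mnmE) !inE.
by case: (j \in I); case: (j \in J); rewrite /= ?addn0 ?subn0 // => /subnK.
Qed.

End Duality.

(** * The coefficient space as a space of derivatives *)
Section CoefficientSpace.
Variables (R : realType) (d n : nat) (A : 'M[int]_(d, n)).
Variables (w : 'cV[R]_n) (Lam : set 'cV[R[i]]_n) (K : {set 'I_n}).
Hypothesis AwK : Aw w Lam K.
Local Notation poly := {mpoly R[i][n]}.

Let bad : set {set 'I_n} := (NS Lam `\` Aw w Lam) `|` Aw_lt w Lam K.

Lemma Qlt_span : Qlt A w Lam K =
  ideal_span ([set f * g | f in range (Ady R A) & g in @dset R n @` NS Lam]
              `|` @dset R n @` bad).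
Proof. by rewrite /Qlt /eA /MLam ideal_mul_span /Plt ideal_add_span. Qed.

Lemma Solpoly_QltP q : Solpoly (Qlt A w Lam K) q <->
  (forall I i, NS Lam I -> dact (Ady R A i) (dact (dset R I) q) = 0) /\
  (forall J, bad J -> dact (dset R J) q = 0).
Proof.
rewrite Qlt_span Solpoly_span; split=> [sol|[solM solP] g].
  split=> [I i NSI|J badJ]; last by apply: sol; right; exists J.
  rewrite -dactM; apply: sol; left; exists (Ady R A i); first by exists i.
  by exists (dset R I) => //; exists I.
case=> [[_ [i _ <-] [_ [I NSI <-] <-]]|[J badJ <-]]; last exact: solP.
by rewrite dactM; apply: solM.
Qed.

(** A family over a finite index type, as the duality lemmas require; index sets
outside the relevant ones are sent to 0, which is homogeneous of every degree. *)
Definition Qgen (x : 'I_d * {set 'I_n} + {set 'I_n}) : poly :=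
  match x with
  | inl (i, J) => if `[< NS Lam J >] then Ady R A i * dset R J else 0
  | inr J => if `[< bad J >] then dset R J else 0
  end.

Lemma Ady_homog i : Ady R A i \is 1.-homog.
Proof.
by apply: rpred_sum => j _; rewrite -scaler_int; apply: rpredZ; rewrite dhomogX /= mdeg1.
Qed.

Lemma dset_homog (I : {set 'I_n}) : dset R I \is #|I|.-homog.
Proof. by rewrite dsetE dhomogX /= mdeg_mesym1. Qed.

Lemma Qgen_homog x :
  Qgen x \is (match x with inl (_, J) => (1 + #|J|)%N | inr J => #|J| end).-homog.
Proof.
case: x => [[i I]|J] /=; case: ifP => _; rewrite ?dhomog0 ?dset_homog //.
by rewrite dhomogM ?Ady_homog ?dset_homog.
Qed.

Lemma Qlt_range : Qlt A w Lam K = ideal_span (range Qgen).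
Proof.
rewrite Qlt_span; apply/seteqP; split; apply: ideal_span_le => f.
  case=> [[_ [i _ <-] [_ [I NSI <-] <-]]|[J badJ <-]]; apply: ideal_span_gen.
    by exists (inl (i, I)) => //=; rewrite asboolT.
  by exists (inr J) => //=; rewrite asboolT.
case=> [[[i I]|J] _ <-] /=; case: asboolP => [H|_]; try exact: ideal_span0;
  apply: ideal_span_gen.
- left; exists (Ady R A i); first by exists i.
  by exists (dset R I) => //; exists I.
- by right; exists J.
Qed.

(** From a family to q by gluing, from q to the family of the d^I . q. *)
Lemma Clt_image : Clt A w Lam K = [set dact (dset R K) q | q in Solpoly (Qlt A w Lam K)].
Proof.
have NSK : NS Lam K by case: AwK.
apply/seteqP; split=> [_ [c [[cA compat c0] clt0] <-]|_ [q /Solpoly_QltP[qM qP] <-]].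
  have [q qE] := monomial_lift compat; exists q; last by rewrite qE.
  apply/Solpoly_QltP; split=> [I i NSI|J badJ]; first by rewrite qE // cA.
  case: badJ => [[NSJ nAJ]|ltJ]; first by rewrite qE // c0.
  by rewrite qE ?clt0 //; case: ltJ => [[]].
exists (fun I => dact (dset R I) q) => //; split; last by move=> J ltJ; apply: qP; right.
split=> [I NSI i|I J NSI NSJ|I NSI nAI]; first exact: qM; last by apply: qP; left.
by rewrite -!dactM !dset_mulD finset.setUC.
Qed.

Let QK := colon (Qlt A w Lam K) (dset R K).

Lemma Clt_Solpoly : Clt A w Lam K = Solpoly QK.
Proof.
rewrite Clt_image /QK Qlt_range; symmetry.
exact: (Solpoly_colon Qgen_homog (dset_homog K)).
Qed.

Lemma AnnS_Clt : AnnS (Clt A w Lam K) = QK.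
Proof.
apply/seteqP; split=> [f annf|f Qf p]; last by rewrite Clt_Solpoly; apply.
rewrite /QK /colon /= Qlt_range -(AnnS_Solpoly Qgen_homog) -Qlt_range => q solq.
by rewrite dactM; apply: annf; rewrite Clt_image; exists q.
Qed.

(** The zero space is the only one annihilated by 1. *)
Lemma Clt_neq0 : Clt A w Lam K <> [set 0] <-> QK <> setT.
Proof.
split=> neq eq0; apply: neq.
  apply/seteqP; split=> [p Cp|_ ->].
    have := AnnS_Clt; rewrite eq0 => /seteqP[_ /(_ 1 I p Cp)].
    by rewrite dact1.
  rewrite Clt_image; exists 0; last by rewrite linear0.
  by move=> f _; rewrite linear0.
rewrite -AnnS_Clt eq0; apply/seteqP; split=> // f _ _ ->; exact: linear0.
Qed.

End CoefficientSpace.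

(** * Differential operators on logarithmic series *)
Section WeylAction.
Variables (R : realType) (n : nat).
Local Notation C := R[i].
Local Notation poly := {mpoly C[n]}.
Local Notation V := (logseries C n).
Implicit Types (P Q : weyl C n) (phi psi : V) (m : 'X_{1..n}).

Lemma weyl_actM P Q phi : weyl_act (P * Q) phi = weyl_act P (weyl_act Q phi).
Proof.
elim/quot_ind: P => f; elim/quot_ind: Q => g.
by rewrite [_ * _]quot_piM !weyl_act_pi free_actM.
Qed.

Lemma weyl_actD P Q phi : weyl_act (P + Q) phi = weyl_act P phi + weyl_act Q phi.
Proof.
elim/quot_ind: P => f; elim/quot_ind: Q => g.
by rewrite [_ + _]quot_piD !weyl_act_pi free_actD.
Qed.

Lemma weyl_act0l phi : weyl_act 0 phi = 0.
Proof. by rewrite [0]/(quot_pi _ 0) weyl_act_pi free_act0. Qed.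

Lemma weyl_act1 phi : weyl_act 1 phi = phi.
Proof. by rewrite [1]/(quot_pi _ 1) weyl_act_pi free_act1. Qed.

Lemma weyl_actN P phi : weyl_act (- P) phi = - weyl_act P phi.
Proof.
by apply/eqP; rewrite -addr_eq0 -weyl_actD addNr weyl_act0l.
Qed.

Lemma weyl_act_suml (I : Type) (r : seq I) (p : pred I) (F : I -> weyl C n) phi :
  weyl_act (\sum_(i <- r | p i) F i) phi = \sum_(i <- r | p i) weyl_act (F i) phi.
Proof.
by elim/big_rec2: _ => [|i f q _ <-]; rewrite ?weyl_act0l ?weyl_actD.
Qed.

Lemma weyl_act_int P (z : int) phi : weyl_act (P *~ z) phi = weyl_act P phi *~ z.
Proof.
have nat_mul k : weyl_act (P *+ k) phi = weyl_act P phi *+ k.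
  by elim: k => [|k IH]; rewrite ?weyl_act0l // !mulrS weyl_actD IH.
by case: z => k; rewrite ?NegzE ?mulrNz ?weyl_actN -!pmulrn nat_mul.
Qed.

Lemma weyl_act_x j phi : weyl_act (weyl_x C j) phi = letter_act (inl j) phi.
Proof. by rewrite weyl_act_pi free_act_x. Qed.

Lemma weyl_act_d j phi : weyl_act (weyl_d C j) phi = letter_act (inr j) phi.
Proof. by rewrite weyl_act_pi free_act_d. Qed.

Lemma weyl_act_c (c : C) phi : weyl_act (weyl_c n c) phi = c *: phi.
Proof.
rewrite weyl_act_pi (free_actEw _ (monalg.msuppZ_le c _)).
rewrite -[in RHS](free_act1 phi) /free_act scaler_sumr; apply: eq_bigr => s _.
by rewrite monalg.mcoeffZ scalerA.
Qed.

Lemma weyl_act0 P : weyl_act P 0 = 0.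
Proof.
by rewrite /weyl_act /free_act big1 // => s _; rewrite word_act0 scaler0.
Qed.

Definition mshift m : 'cV[C]_n := \col_j (m j)%:R.

(** The operator on p by which d_x^m acts on x^gamma p(log x): a falling
factorial of gamma_j + d_{y_j} in each coordinate. *)
Definition falling m (gam : 'cV[C]_n) : poly :=
  \prod_(j < n) \prod_(k < m j) ((gam j 0 - k%:R)%:MP + 'X_j).

Definition diffop m phi : V :=
  fun gam => dact (falling m (gam + mshift m)) (phi (gam + mshift m)).

Lemma mshiftD m1 m2 : mshift (m1 + m2) = mshift m1 + mshift m2.
Proof. by apply/colP => j; rewrite !mxE mnmDE natrD. Qed.

Lemma diffop0 phi : diffop 0 phi = phi.
Proof.
apply/funext => gam; rewrite /diffop /falling big1 ?dact1.
  by congr phi; apply/colP => j; rewrite !mxE mnm0E addr0.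
by move=> j _; rewrite mnm0E big_ord0.
Qed.

Lemma diffopD m1 m2 phi : diffop (m1 + m2) phi = diffop m1 (diffop m2 phi).
Proof.
apply/funext => gam; rewrite /diffop -dactM -addrA -mshiftD; congr dact.
rewrite /falling -big_split; apply: eq_bigr => j _ /=.
rewrite mnmDE addnC big_split_ord mulrC /=; congr (_ * _); apply: eq_bigr => k _.
by rewrite !mxE mnmDE !natrD opprD !addrA addrK.
Qed.

Lemma diffop_U j phi : diffop U_(j) phi = weyl_act (weyl_d C j) phi.
Proof.
rewrite weyl_act_d; apply/funext => gam; rewrite /diffop /=.
have -> : mshift U_(j) = delta_mx j 0.
  by apply/colP => i; rewrite !mxE mnm1E eqxx andbT eq_sym.
rewrite /falling (bigD1 j) //= mnm1E eqxx big_ord_recl big_ord0 subr0 mulr1.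
rewrite big1 ?mulr1; last by move=> i /negPf; rewrite mnm1E eq_sym => ->; rewrite big_ord0.
by rewrite dactDl dactC dactX mderivmU1m.
Qed.

Lemma weyl_act_monomial m phi :
  weyl_act (\prod_(j < n) weyl_d C j ^+ m j) phi = diffop m phi.
Proof.
have act_exp j k psi : weyl_act (weyl_d C j ^+ k) psi = diffop (U_(j) *+ k) psi.
  elim: k => [|k IH]; first by rewrite expr0 mulm0n weyl_act1 diffop0.
  by rewrite exprS mulmS weyl_actM diffopD IH diffop_U.
rewrite [in RHS](multinomUE_id m).
elim: (index_enum _) phi => [|j r IH] phi; first by rewrite !big_nil weyl_act1 diffop0.
by rewrite !big_cons weyl_actM diffopD IH act_exp.
Qed.

Lemma weyl_act_polyE (p : poly) phi :
  weyl_act (weyl_of_poly p) phi = mono_ext (diffop^~ phi) p.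
Proof.
rewrite weyl_act_suml; apply: eq_bigr => m _.
by rewrite weyl_actM weyl_act_c weyl_act_monomial.
Qed.

End WeylAction.

(** * The equations of the hypergeometric system *)
Section HypergeometricSystem.
Variables (R : realType) (d n : nat) (A : 'M[int]_(d, n)) (beta : 'cV[R[i]]_d).
Local Notation C := R[i].
Local Notation poly := {mpoly C[n]}.
Local Notation V := (logseries C n).
Implicit Types (phi : V) (gam lam : 'cV[C]_n).

(** A left ideal kills a series as soon as its generators do; for the toric
ideal, polynomial multiples of the binomials reduce to monomial multiples. *)
Lemma HA_annihilatesP phi :
  (forall P, HA A beta P -> weyl_act P phi = 0) <->
  (forall u, latticeL A u -> diffop (upos u) phi = diffop (upos (- u)) phi) /\
  (forall i, weyl_act (euler_op A beta i) phi = 0).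
Proof.
split=> [annih|[toric euler] _ [P [Q [[s sI ->] [t tE ->] ->]]]].
  split=> [u Lu|i]; last first.
    by apply: annih; exists 0, (euler_op A beta i); rewrite add0r; split=> //;
      [exact: ideal_span0|apply: ideal_span_gen; exists i].
  pose f : poly := 'X_[upos u] - 'X_[upos (- u)].
  have : weyl_act (weyl_of_poly f) phi = 0.
    apply: annih; exists (weyl_of_poly f), 0; rewrite addr0; split=> //;
      last exact: ideal_span0.
    by apply: ideal_span_gen; exists f => //; apply: ideal_span_gen; exists u.
  rewrite weyl_act_polyE mono_extD -scaleN1r mono_extZ !mono_extX scaleN1r.
  by move/eqP; rewrite subr_eq0 => /eqP.
rewrite weyl_actD !weyl_act_suml !big_seq !big1 ?addr0 // => p.
  move/tE => [i _ <-]; by rewrite weyl_actM euler weyl_act0.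
move/sI => [f If <-]; rewrite weyl_actM weyl_act_polyE.
suff -> : mono_ext (fun m => diffop m phi) f = 0 by rewrite weyl_act0.
have {If} [r rG ->] := If; rewrite big_seq.
apply: (big_ind (fun f => mono_ext (fun m => diffop m phi) f = 0)).
- exact: mono_ext0.
- by move=> g h; rewrite mono_extD => -> ->; rewrite addr0.
move=> [g h] /rG /= [u Lu <-]; rewrite [g]mpolyE mulr_suml.
apply: (big_ind (fun f => mono_ext (fun m => diffop m phi) f = 0)).
- exact: mono_ext0.
- by move=> f1 f2; rewrite mono_extD => -> ->; rewrite addr0.
move=> m _; rewrite -scalerAl mono_extZ mulrBr -!mpolyXD mono_extD -scaleN1r mono_extZ !mono_extX.
have diffD m1 m2 : diffop (m1 + m2) phi = diffop m1 (diffop m2 phi) by exact: diffopD.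
by rewrite !diffD toric // scaleN1r subrr scaler0.
Qed.

(** On x^gamma p(log x) the operator theta_j is gamma_j + d_{y_j}. *)
Lemma weyl_act_euler i phi gam :
  weyl_act (euler_op A beta i) phi gam =
  ((map_mx intr A *m gam - beta) i 0) *: phi gam + dact (Ady R A i) (phi gam).
Proof.
have addE (f g : V) x : (f + g) x = f x + g x by [].
have oppE (f : V) x : (- f) x = - f x by [].
have intE (f : V) (z : int) x : (f *~ z) x = f x *~ z.
  have natE k : (f *+ k) x = f x *+ k by elim: k => // k IH; rewrite !mulrS addE IH.
  by case: z => k; rewrite ?NegzE ?mulrNz ?oppE -!pmulrn natE.
have sumE (F : 'I_n -> V) x : (\sum_j F j) x = \sum_j F j x.
  by elim/big_rec2: _ => // j p f _ <-; rewrite addE.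
rewrite weyl_actD weyl_actN weyl_act_c weyl_act_suml addE oppE sumE.
rewrite dact_suml 3!mxE scalerDl addrAC scaleNr; congr (_ - _).
rewrite scaler_suml -big_split; apply: eq_bigr => j _ /=.
rewrite weyl_act_int intE weyl_actM weyl_act_x weyl_act_d /= subrK !mxE.
rewrite -scalerA scaler_int -[X in dact X _]scaler_int dactZl dactX mderivmU1m.
by rewrite scaler_int mulrzDl.
Qed.

End HypergeometricSystem.

(** * Normalising units *)
Section FrobeniusUnits.
Variables (R : realType) (n : nat) (lam : 'cV[R[i]]_n).
Local Notation C := R[i].
Local Notation poly := {mpoly C[n]}.
Implicit Types (j : 'I_n) (s : int) (z : 'cV[int]_n).

(** Membership of j in nsupp, in terms of the integer offset s from the base
point lam. *)
Definition negint j s : bool := `[< exists k : nat, lam j 0 + s%:~R = - (k.+1)%:R >].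

Lemma in_nsupp z j : (j \in nsupp (lam + toC R z)) = negint j (z j 0).
Proof. by rewrite inE !mxE. Qed.

Lemma negint_pred j s : negint j (s - 1) = negint j s || (lam j 0 + s%:~R == 0).
Proof.
apply/asboolP/orP => [[[|k] /eqP]|[/asboolP[k sk]|/eqP s0]].
- by rewrite rmorphB /= addrA subr_eq addNr => ->; right.
- rewrite rmorphB /= addrA subr_eq [in - _]mulrS opprD addrAC addNr add0r => /eqP sk.
  by left; apply/asboolP; exists k.
- by exists k.+1; rewrite rmorphB /= addrA sk [in RHS]mulrS opprD addrC.
- by exists 0; rewrite rmorphB /= addrA s0 add0r.
Qed.

Lemma negint_neq0 j s : negint j s -> lam j 0 + s%:~R != 0.
Proof. by move=> /asboolP[k ->]; rewrite oppr_eq0 pnatr_eq0. Qed.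

Definition linfac j s : poly := (lam j 0 + s%:~R)%:MP + 'X_j.

(** The factor of a falling factorial at offset s, with the degenerate factor
d_{y_j} replaced by 1, so that its constant term never vanishes. *)
Definition unitfac j s : poly := if lam j 0 + s%:~R == 0 then 1 else linfac j s.

(** The quotient gamnum / gamden solves G(s) = unitfac(s) G(s - 1), as a ratio of
Gamma functions would; it is kept as a pair of polynomials with nonzero
constant term, of which at most one is nontrivial. *)
Definition gamnum j s : poly :=
  if s is Posz a then \prod_(k < a) unitfac j k.+1 else 1.

Definition gamden j s : poly :=
  if s is Negz a then \prod_(k < a.+1) unitfac j (- k%:Z) else 1.

Lemma gam_step j s :
  unitfac j s * (gamnum j (s - 1) * gamden j s) = gamnum j s * gamden j (s - 1).
Proof.
case: s => [[|a]|a].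
- by rewrite /= subnn big_ord_recl !big_ord0 /= oppr0 !mulr1 mul1r.
- have -> : Posz a.+1 - 1 = Posz a by rewrite -addn1 PoszD addrK.
  by rewrite /= big_ord_recr /= !mulr1 mulrC.
have -> : Negz a - 1 = Negz a.+1 by rewrite !NegzE -opprD -PoszD addn1.
by rewrite /= [in RHS]big_ord_recr /= !mul1r mulrC NegzE.
Qed.

(** The contribution of the step from s down to t that is not invertible:
d_{y_j} if the coordinate becomes a negative integer on the way. *)
Definition cross j s t : poly := if negint j t && ~~ negint j s then 'X_j else 1.

Lemma linfac_split j s : linfac j s = cross j s (s - 1) * unitfac j s.
Proof.
rewrite /cross /unitfac negint_pred; case: eqP => [s0|_]; last first.
  by rewrite orbF andbN mul1r.
have /negbTE -> : ~~ negint j s by apply/negP => /negint_neq0; rewrite s0 eqxx.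
by rewrite /= mulr1 /linfac s0 mpolyC0 add0r.
Qed.

Lemma crossM j s (m : nat) :
  cross j s (s - m%:Z) * cross j (s - m%:Z) (s - m%:Z - 1) = cross j s (s - m.+1%:Z).
Proof.
have -> : s - m.+1%:Z = s - m%:Z - 1 by rewrite -addn1 PoszD opprD addrA.
have negint_mono : negint j s -> negint j (s - m%:Z).
  move=> ns; elim: m => [|m IH]; first by rewrite subr0.
  by rewrite -addn1 PoszD opprD addrA negint_pred IH.
rewrite /cross negint_pred; case: (negint j s) negint_mono => [->//|_]; first by rewrite !mulr1.
by case: (negint j _) => /=; rewrite ?mulr1 ?mul1r ?andbT.
Qed.

Lemma unitfac_const j s : (unitfac j s)@_0 != 0.
Proof.
rewrite /unitfac; case: ifP => [_|/negbT s0]; first by rewrite mcoeff1 eqxx oner_eq0.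
by rewrite mcoeffD mcoeffC eqxx mulr1 mcoeffX mnm1_eq0 addr0.
Qed.

Lemma prod_const_neq0 (I : finType) (F : I -> poly) :
  (forall i, (F i)@_0 != 0) -> (\prod_i F i)@_0 != 0.
Proof.
move=> F0; apply: (big_ind (fun p : poly => p@_0 != 0)) => // [|p q p0 q0].
  by rewrite mcoeff1 eqxx oner_eq0.
by rewrite (rmorphM (mcoeff 0%MM)) mulf_neq0.
Qed.

Lemma gamnum_const j s : (gamnum j s)@_0 != 0.
Proof.
case: s => a /=; last by rewrite mcoeff1 eqxx oner_eq0.
by apply: prod_const_neq0 => k; apply: unitfac_const.
Qed.

Lemma gamden_const j s : (gamden j s)@_0 != 0.
Proof.
case: s => a /=; first by rewrite mcoeff1 eqxx oner_eq0.
by apply: prod_const_neq0 => k; apply: unitfac_const.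
Qed.

Lemma const_neq0 (p : poly) : p@_0 != 0 -> p != 0.
Proof. by apply: contraNneq => ->; rewrite mcoeff0. Qed.

(** One coordinate of a falling factorial is its crossing factor times
G(s) / G(s - m), with the denominators cleared. *)
Lemma falling_coord j s (m : nat) :
  (\prod_(k < m) linfac j (s - k%:Z)) * (gamnum j (s - m%:Z) * gamden j s) =
  cross j s (s - m%:Z) * (gamnum j s * gamden j (s - m%:Z)).
Proof.
elim: m => [|m IH]; first by rewrite big_ord0 subr0 /cross andbN.
rewrite -crossM; have -> : s - m.+1%:Z = s - m%:Z - 1 by rewrite -addn1 PoszD opprD addrA.
rewrite big_ord_recr /= linfac_split; move: IH; set t := s - m%:Z => IH.
apply: (mulIf (const_neq0 (gamden_const j t))).
move: (gam_step j t) IH; move: (cross j t _) (cross j s _) (unitfac j t) => x y u.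
move: (gamnum j (t - 1)) (gamden j t) (gamnum j t) (gamnum j s) (gamden j s) (gamden j (t - 1)).
move: (\prod_(k < m) _) => P a b c e f g E1 E2.
transitivity ((P * (c * f)) * x * g).
  transitivity (P * f * x * (u * (a * b))); last by rewrite E1; ring.
  by ring.
by rewrite E2; ring.
Qed.

Definition unitnum z : poly := \prod_j gamnum j (z j 0).
Definition unitden z : poly := \prod_j gamden j (z j 0).

Lemma unitnum_const z : (unitnum z)@_0 != 0.
Proof. by apply: prod_const_neq0 => j; apply: gamnum_const. Qed.

Lemma unitden_const z : (unitden z)@_0 != 0.
Proof. by apply: prod_const_neq0 => j; apply: gamden_const. Qed.

(** The operator d_x^m from exponent z to exponent t acts, up to the units
attached to z and t, as the monomial in the coordinates that turn negative. *)
Lemma falling_cross (m : 'X_{1..n}) z (t : 'cV[int]_n) : (forall j, t j 0 = z j 0 - (m j)%:Z) ->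
  falling m (lam + toC R z) * (unitnum t * unitden z) =
  dset R (nsupp (lam + toC R t) :\: nsupp (lam + toC R z)) * (unitnum z * unitden t).
Proof.
move=> tE; rewrite /dset [in RHS]big_mkcond -!big_split; apply: eq_bigr => j _ /=.
rewrite finset.in_setD !in_nsupp tE andbC -[if _ then _ else _]/(cross j (z j 0) (z j 0 - (m j)%:Z)).
rewrite -falling_coord; congr (_ * _); apply: eq_bigr => k _.
by rewrite !mxE /linfac intrD mulrNz addrA.
Qed.

End FrobeniusUnits.

(** * Solutions supported in an exponent lattice *)
Section FrobeniusSeries.
Variables (R : realType) (d n : nat) (lam : 'cV[R[i]]_n).
Local Notation C := R[i].
Local Notation poly := {mpoly C[n]}.
Local Notation V := (logseries C n).
Local Notation E z := (lam + toC R z).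
Local Notation unum := (unitnum lam).
Local Notation uden := (unitden lam).
Implicit Types (phi : V) (c : {set 'I_n} -> poly) (z u t : 'cV[int]_n).

Lemma toCD z u : toC R (z + u) = toC R z + toC R u.
Proof. exact: map_mxD. Qed.

Lemma toCB z u : toC R (z - u) = toC R z - toC R u.
Proof. exact: map_mxB. Qed.

Lemma toC_inj : injective (@toC R n).
Proof.
move=> z u /colP eq_zu; apply/colP => j; have := eq_zu j; rewrite !mxE.
exact: (@intr_inj C).
Qed.

Lemma base_inj z u : E z = E u -> z = u.
Proof. by move/addrI/toC_inj. Qed.

Lemma mshift_upos u : toC R u = mshift R (upos u) - mshift R (upos (- u)).
Proof.
apply/colP => j; rewrite !mxE !mnmE !mxE; set a := u j 0; rewrite -[LHS]/(a%:~R).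
rewrite {1}(_ : a = (absz (Num.max a 0))%:Z - (absz (Num.max (- a) 0))%:Z); last lia.
by rewrite intrD mulrNz.
Qed.

Lemma shift_upos_diff z z' : E z - mshift R (upos (z - z')) +
  mshift R (upos (- (z - z'))) = E z'.
Proof.
rewrite -addrA [- _ + _]addrC -[_ - _]opprB -mshift_upos toCB opprB.
by rewrite -addrA [toC R z + _]addrC subrK.
Qed.

(** Here c stands for the normalised coefficient at z, the image of p under the
unit unitnum / unitden. *)
Lemma falling_frobenius (m : 'X_{1..n}) z t (c p : poly) :
  (forall j, t j 0 = z j 0 - (m j)%:Z) ->
  dact (uden z) c = dact (unum z) p ->
  dact (unum t) (dact (falling m (E z)) p) =
  dact (uden t) (dact (dset R (nsupp (E t) :\: nsupp (E z))) c).
Proof.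
move=> tE cp; apply: (dact_unit_inj (unitden_const lam z)).
transitivity (dact (falling m (E z) * (unum t * uden z)) p).
  by rewrite -!dactM; congr (dact _ p); ring.
rewrite (falling_cross lam tE); set D := dset R _.
transitivity (dact (D * uden t) (dact (unum z) p)).
  by rewrite -dactM; congr (dact _ p); ring.
by rewrite -cp -!dactM; congr (dact _ c); ring.
Qed.

Lemma nsupp_min z z' t : (forall j, t j 0 = Num.min (z j 0) (z' j 0)) ->
  nsupp (E t) = (nsupp (E z) :|: nsupp (E z'))%SET.
Proof.
have negint_le j a b : a <= b -> negint lam j b -> negint lam j a.
  move=> le_ab; have -> : a = b - (absz (b - a))%:Z by lia.
  move=> nb; elim: (absz _) => [|k IH]; first by rewrite subr0.
  by rewrite -addn1 PoszD opprD addrA negint_pred IH.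
move=> tE; apply/setP => j; rewrite finset.in_setU !in_nsupp tE.
have [le_zz'|/ltW le_z'z] := leP (z j 0) (z' j 0).
  apply/idP/orP => [->|[//|/negint_le]]; [by left | exact].
by apply/idP/orP => [->|[/negint_le|//]]; [right | exact].
Qed.

(** The binomial of u compares the coefficients at z and z' = z - u through their
common image at the coordinatewise minimum of z and z', whose negative support
is the union of those of z and z'. *)
Lemma toric_frobenius z z' u (c c' p p' : poly) : z = z' + u ->
  dact (uden z) c = dact (unum z) p ->
  dact (uden z') c' = dact (unum z') p' ->
  dact (falling (upos u) (E z)) p = dact (falling (upos (- u)) (E z')) p' <->
  dact (dset R (nsupp (E z') :\: nsupp (E z))) c =
  dact (dset R (nsupp (E z) :\: nsupp (E z'))) c'.
Proof.
move=> zE cp cp'.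
pose t : 'cV[int]_n := \col_j Num.min (z j 0) (z' j 0).
have tE j : t j 0 = z j 0 - (upos u j)%:Z.
  rewrite mxE mnmE zE !mxE; move: (z' j 0) (u j 0) => a b; lia.
have tE' j : t j 0 = z' j 0 - (upos (- u) j)%:Z.
  rewrite mxE mnmE zE !mxE; move: (z' j 0) (u j 0) => a b; lia.
have tU : nsupp (E t) = (nsupp (E z) :|: nsupp (E z'))%SET.
  by apply: nsupp_min => j; rewrite mxE.
have := falling_frobenius tE cp; have := falling_frobenius tE' cp'.
rewrite tU !finset.setDUl !finset.setDv finset.setU0 finset.set0U => eq' eq.
split=> [eqf|eqd].
  by apply: (dact_unit_inj (unitden_const lam t)); rewrite -eq -eq' eqf.
by apply: (dact_unit_inj (unitnum_const lam t)); rewrite eq eq' eqd.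
Qed.

Variables (A : 'M[int]_(d, n)) (beta : 'cV[C]_d).
Hypothesis lam_beta : map_mx intr A *m lam = beta.
Local Notation L := (latticeL A).
Let Lam : set 'cV[C]_n := [set E u | u in L].

(** The series phi and the family c correspond under normalisation; the
coefficient at z depends on z only through its negative support. *)
Definition frobenius_coeff phi c := forall z, L z ->
  dact (uden z) (c (nsupp (E z))) = dact (unum z) (phi (E z)).

Lemma latticeLB z u : L z -> L u -> L (z - u).
Proof. by rewrite /latticeL /= mulmxBr => -> ->; rewrite subrr. Qed.

Lemma latticeLD z u : L z -> L u -> L (z + u).
Proof. by rewrite /latticeL /= mulmxDr => -> ->; rewrite addr0. Qed.

Lemma NSP J : NS Lam J <-> exists2 z, L z & nsupp (E z) = J.
Proof.
split=> [[_ [[z Lz <-] zJ]]|[z Lz zJ]]; first by exists z.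
by exists (E z); split=> //; exists z.
Qed.

Lemma frobenius_coeff_neq0 phi c z : frobenius_coeff phi c -> L z ->
  phi (E z) <> 0 <-> c (nsupp (E z)) <> 0.
Proof.
move=> frob Lz; have cphi := frob z Lz.
split=> neq eq0; apply: neq.
  by apply: (dact_unit_inj (unitnum_const lam z)); rewrite -cphi eq0 !linear0.
by apply: (dact_unit_inj (unitden_const lam z)); rewrite cphi eq0 !linear0.
Qed.

Lemma toric_solP phi c : Supp phi `<=` Lam -> frobenius_coeff phi c ->
  (forall u, L u -> diffop (upos u) phi = diffop (upos (- u)) phi) <->
  (forall z z', L z -> L z' ->
     dact (dset R (nsupp (E z') :\: nsupp (E z))) (c (nsupp (E z))) =
     dact (dset R (nsupp (E z) :\: nsupp (E z'))) (c (nsupp (E z')))).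
Proof.
move=> suppL frob; split=> [toric z z' Lz Lz'|compat u Lu].
  have zE : z = z' + (z - z') by rewrite addrC subrK.
  apply/(toric_frobenius zE (frob z Lz) (frob z' Lz')).
  have Lu := latticeLB Lz Lz'.
  have := congr1 (@^~ (E z - mshift R (upos (z - z')))) (toric _ Lu).
  by rewrite /diffop subrK shift_upos_diff.
apply/funext => gam; rewrite /diffop.
have gamE : gam + mshift R (upos u) = gam + mshift R (upos (- u)) + toC R u.
  by rewrite mshift_upos -addrA [mshift R (upos (- u)) + _]addrC subrK.
have out del : ~ Lam del -> phi del = 0.
  by move=> nL; apply: contrapT => /suppL.
have [[z Lz zE]|nL] := pselect (Lam (gam + mshift R (upos u))).
  have z'E : gam + mshift R (upos (- u)) = E (z - u).
    by rewrite toCB addrA zE gamE addrK.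
  have Lz' := latticeLB Lz Lu; rewrite z'E -zE.
  apply/(toric_frobenius _ (frob z Lz) (frob _ Lz')); first by rewrite subrK.
  exact: compat.
rewrite !out ?linear0 // => -[z' Lz' z'E]; apply: nL.
by exists (z' + u); [exact: latticeLD | rewrite gamE -z'E toCD addrA].
Qed.

(** The Euler operators become the conditions of e_A because A gamma = beta on
Lambda, and they commute with the normalising units. *)
Lemma HA_frobeniusP phi c : Supp phi `<=` Lam -> frobenius_coeff phi c ->
  (forall P, HA A beta P -> weyl_act P phi = 0) <->
  (forall J, NS Lam J -> forall i, dact (Ady R A i) (c J) = 0) /\
  (forall J J', NS Lam J -> NS Lam J' ->
     dact (dset R (J' :\: J)) (c J) = dact (dset R (J :\: J')) (c J')).
Proof.
move=> suppL frob; rewrite HA_annihilatesP (toric_solP suppL frob).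
have eulerE i gam : weyl_act (euler_op A beta i) phi gam = dact (Ady R A i) (phi gam).
  rewrite weyl_act_euler; have [[z Lz <-]|nL] := pselect (Lam gam); last first.
    have -> : phi gam = 0 by apply: contrapT => /suppL.
    by rewrite scaler0 add0r.
  rewrite mulmxDr lam_beta addrAC subrr add0r -map_mxM /=.
  by rewrite (_ : A *m z = 0) // map_mx0 mxE scale0r add0r.
have commA i z : L z -> dact (uden z) (dact (Ady R A i) (c (nsupp (E z)))) =
    dact (unum z) (dact (Ady R A i) (phi (E z))).
  by move=> Lz; rewrite dactMC (frob z Lz) dactMC.
split=> [[compat euler]|[euler compat]]; split.
- move=> J /NSP[z Lz <-] i; apply: (dact_unit_inj (unitden_const lam z)).
  by rewrite commA // -eulerE euler !linear0.
- by move=> J J' /NSP[z Lz <-] /NSP[z' Lz' <-]; apply: compat.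
- by move=> z z' Lz Lz'; apply: compat; apply/NSP; [exists z|exists z'].
- move=> i; apply/funext => gam; rewrite eulerE.
  have [[z Lz <-]|nL] := pselect (Lam gam); last first.
    have -> : phi gam = 0 by apply: contrapT => /suppL.
    by rewrite linear0.
  apply: (dact_unit_inj (unitnum_const lam z)).
  by rewrite -commA // euler ?linear0 //; apply/NSP; exists z.
Qed.

(** For two exponents with the same negative support the binomial relation has
no crossing factors, so their normalised coefficients coincide. *)
Lemma frobenius_coeff_exists phi :
  (forall P, HA A beta P -> weyl_act P phi = 0) -> exists c, frobenius_coeff phi c.
Proof.
move=> /HA_annihilatesP[toric _].
pose cset J : set poly := [set q | exists z,
  [/\ L z, nsupp (E z) = J & dact (uden z) q = dact (unum z) (phi (E z))]].
exists (fun J => xget 0 (cset J)) => z Lz.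
have [q qE] := dact_unit_surj (dact (unum z) (phi (E z))) (unitden_const lam z).
have := @xgetPex _ 0 (cset (nsupp (E z))) (ex_intro _ q (ex_intro _ z (And3 Lz erefl qE))).
set q' := xget _ _ => -[z' [Lz' z'z q'E]]; rewrite -qE; congr dact.
have zE : z = z' + (z - z') by rewrite addrC subrK.
have [+ _] := toric_frobenius zE qE q'E.
rewrite z'z finset.setDv /dset big_set0 !dact1 => <- //.
have := congr1 (@^~ (E z - mshift R (upos (z - z')))) (toric _ (latticeLB Lz Lz')).
by rewrite /diffop subrK shift_upos_diff.
Qed.

Lemma frobenius_series_exists c :
  exists2 phi, Supp phi `<=` Lam & frobenius_coeff phi c.
Proof.
pose pset gam : set poly := [set p | exists z,
  [/\ L z, E z = gam & dact (uden z) (c (nsupp (E z))) = dact (unum z) p]].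
exists (fun gam => xget 0 (pset gam)) => [gam|z Lz].
  rewrite /Supp /=; case: xgetP => [p -> [z [Lz <- _]] _|//]; by exists z.
have [p pE] := dact_unit_surj (dact (uden z) (c (nsupp (E z)))) (unitnum_const lam z).
have := @xgetPex _ 0 (pset (E z)) (ex_intro _ p (ex_intro _ z (And3 Lz erefl (esym pE)))).
by move=> [z' [Lz' /base_inj ->]].
Qed.

End FrobeniusSeries.

(** * Minima of weights on the pieces of a lattice *)

(** Dickson's lemma, for the quasi-order on X given by finitely many functions
to nat, by induction on their number.  A basis for the remaining functions
handles all y whose f y is above its largest value N of f; below N there are
only finitely many slices of constant f, each with a basis by induction. *)
Lemma dickson_basis (X : eqType) (a : seq (X -> nat)) (P : set X) :
  exists2 s : seq X, (forall x, x \in s -> P x) &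
    forall y, P y -> exists2 x, x \in s & all (fun f => f x <= f y)%N a.
Proof.
elim: a P => [|f a IH] P.
  have [[x Px]|nP] := pselect (P !=set0).
    by exists [:: x] => [y|y _]; rewrite ?inE => /eqP -> || exists x; rewrite ?inE.
  by exists [::] => // y Py; case: nP; exists y.
have [s sP s_le] := IH P.
pose N := \max_(x <- s) f x.
have slice k : exists2 t : seq X, (forall x, x \in t -> P x) &
    forall y, P y -> (f y < k)%N ->
      exists2 x, x \in t & all (fun g => g x <= g y)%N (f :: a).
  elim: k => [|k [t tP t_le]]; first by exists [::].
  have [r rP r_le] := IH [set y | P y /\ f y = k].
  exists (t ++ r) => [x|y Py]; first by rewrite mem_cat => /orP[/tP|/rP[]].
  rewrite ltnS leq_eqVlt => /orP[/eqP fy|/(t_le _ Py)[x xt le]]; last first.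
    by exists x; rewrite ?mem_cat ?xt.
  have [x xr le] := r_le y (conj Py fy); exists x; first by rewrite mem_cat xr orbT.
  by have [_ fx] := rP x xr; rewrite /= fx fy leqnn.
have [t tP t_le] := slice N.
exists (s ++ t) => [x|y Py]; first by rewrite mem_cat => /orP[/sP|/tP].
have [/(t_le y Py)[x xt le]|le_N] := ltnP (f y) N.
  by exists x; rewrite ?mem_cat ?xt ?orbT.
have [x xs le] := s_le y Py; exists x; first by rewrite mem_cat xs.
by rewrite /= le andbT (leq_trans _ le_N) //; apply: leq_bigmax_seq.
Qed.

Lemma dickson_argmin (disp : Order.disp_t) (T : orderType disp) (X : eqType)
    (a : seq (X -> nat)) (P : set X) (h : X -> T) :
  P !=set0 ->
  (forall x y, P x -> P y -> all (fun f => f x <= f y)%N a -> (h x <= h y)%O) ->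
  exists2 x, P x & forall y, P y -> (h x <= h y)%O.
Proof.
move=> [x0 Px0] mono; have [s sP s_le] := dickson_basis a P.
have [x1 x1s _] := s_le x0 Px0.
have [x xs x_min] : exists2 x, x \in s & forall y, y \in s -> (h x <= h y)%O.
  elim: s x1 x1s {sP s_le} => // z s IH x1 _.
  case: s IH => [_|y s IH].
    by exists z; rewrite ?mem_head // => y; rewrite inE => /eqP ->.
  have [x xs x_min] := IH y (mem_head y s).
  have [le_zx|/ltW le_xz] := leP (h z) (h x).
    exists z; first exact: mem_head.
    move=> t; rewrite in_cons => /orP[/eqP -> //|/x_min]; exact: le_trans.
  exists x; first by rewrite in_cons xs orbT.
  by move=> t; rewrite in_cons => /orP[/eqP -> //|/x_min].
exists x => [|y Py]; first exact: sP.
have [z zs le_zy] := s_le y Py.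
exact: le_trans (x_min z zs) (mono _ _ (sP z zs) Py le_zy).
Qed.

(** * Initial exponents *)
Section InitialExponents.
Variables (R : realType) (d n : nat) (A : 'M[int]_(d, n)) (beta : 'cV[R[i]]_d).
Variables (w : 'cV[R]_n) (lam : 'cV[R[i]]_n).
Local Notation C := R[i].
Local Notation poly := {mpoly C[n]}.
Local Notation E z := (lam + toC R z).
Local Notation L := (latticeL A).
Hypothesis w_generic : L_generic A w.
Hypothesis lam_beta : map_mx intr A *m lam = beta.
Let Lam : set 'cV[C]_n := [set E u | u in L].
Implicit Types (z u : 'cV[int]_n) (gam : 'cV[C]_n).

(** The values of w on integer vectors are real, which gives a total order on
the exponents; the order on C is only partial. *)
Definition weight z : R := \sum_j w j 0 * (z j 0)%:~R.

Lemma weightB z u : weight (z - u) = weight z - weight u.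
Proof.
rewrite /weight -sumrB; apply: eq_bigr => j _.
by rewrite !mxE intrD mulrNz mulrDr mulrN.
Qed.

Lemma weight_line (k : int) z u :
  weight (z + k *: (u - z)) = weight z + k%:~R * (weight u - weight z).
Proof.
rewrite -weightB /weight mulr_sumr -big_split; apply: eq_bigr => j _ /=.
by rewrite !mxE intrD intrM mulrDr [in RHS]mulrCA.
Qed.

Lemma dotw_toC z : dotw w (toC R z) = (weight z)%:C%C.
Proof.
rewrite /dotw /weight rmorph_sum; apply: eq_bigr => j _.
by rewrite !mxE rmorphM /= rmorph_int.
Qed.

Lemma dotwB_base z u : dotw w (E z - E u) = (weight z - weight u)%:C%C.
Proof. by rewrite opprD addrACA subrr add0r -toCB dotw_toC weightB. Qed.

Lemma lew_base z u : lew w (E z) (E u) <-> weight z <= weight u.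
Proof.
by rewrite /lew dotwB_base -[0]/(0%:C%C) lecR subr_ge0.
Qed.

Lemma weight_inj z u : L z -> L u -> weight z = weight u -> z = u.
Proof.
move=> Lz Lu eqw; apply/eqP; rewrite -subr_eq0; apply: contraT => /w_generic.
by rewrite dotw_toC weightB eqw subrr eqxx => /(_ (latticeLB Lz Lu)).
Qed.

Lemma lew_refl gam : lew w gam gam.
Proof. by rewrite /lew subrr /dotw big1 // => j _; rewrite mxE mulr0. Qed.

Lemma lew_anti gam gam' : Lam gam -> Lam gam' ->
  lew w gam gam' -> lew w gam' gam -> gam = gam'.
Proof.
move=> [z Lz <-] [u Lu <-] /lew_base le1 /lew_base le2.
by rewrite (weight_inj Lz Lu) //; apply/eqP; rewrite eq_le le1.
Qed.

Lemma lew_trans gam1 gam2 gam3 : Lam gam1 -> Lam gam2 -> Lam gam3 ->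
  lew w gam1 gam2 -> lew w gam2 gam3 -> lew w gam1 gam3.
Proof.
move=> [z1 _ <-] [z2 _ <-] [z3 _ <-] /lew_base le1 /lew_base le2.
by apply/lew_base; apply: le_trans le1 le2.
Qed.

Lemma lew_total gam gam' : Lam gam -> Lam gam' -> lew w gam gam' \/ lew w gam' gam.
Proof.
move=> [z _ <-] [u _ <-]; have [le|/ltW le] := leP (weight z) (weight u).
  by left; apply/lew_base.
by right; apply/lew_base.
Qed.

Lemma wminP (X : set 'cV[C]_n) gam : X `<=` Lam -> wmins w X gam -> wmin w X = gam.
Proof.
move=> subX minX; have [Xgam le_gam] := minX.
have [Xm le_m] := @xgetPex _ 0 (wmins w X) (ex_intro _ _ minX).
by apply: lew_anti; [exact: subX|exact: subX|exact: le_m|exact: le_gam].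
Qed.

Lemma Lam_sub J : Lam_ Lam J `<=` Lam.
Proof. by move=> gam []. Qed.

(** If lambda_j is an integer, the distance of the coordinate from 0; otherwise j
is in no negative support and imposes no condition. *)
Definition wall_dist (j : 'I_n) z : nat :=
  if pselect (exists b : int, lam j 0 = b%:~R) is left ex
  then absz (xget 0 [set b : int | lam j 0 = b%:~R] + z j 0) else 0%N.

(** Moving away from the walls: if z' is at least as far from the wall as z,
on the same side, then so is every point of the ray from z through z'. *)
Lemma negint_translate (k : nat) j z z' : negint lam j (z j 0) = negint lam j (z' j 0) ->
  (wall_dist j z <= wall_dist j z')%N ->
  negint lam j (z j 0 + k%:Z * (z' j 0 - z j 0)) = negint lam j (z j 0).
Proof.
rewrite /wall_dist; case: pselect => [ex|nex] /=; last first.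
  have nneg s : negint lam j s = false.
    apply/asboolP => -[i lamE]; apply: nex; exists (- s - i.+1%:Z).
    by rewrite intrD !mulrNz -lamE; rewrite addrC addrK.
  by rewrite !nneg.
have := @xgetPex _ 0 [set b : int | lam j 0 = b%:~R] ex.
move: (xget _ _) => b /= lamE.
have negintE s : negint lam j s = (b + s < 0).
  apply/asboolP/idP => [[m]|lt0].
    rewrite lamE -intrD -[RHS](mulrNz 1 m.+1%:Z) => /intr_inj ->; lia.
  exists (absz (b + s)).-1.
  rewrite lamE -intrD -[RHS](mulrNz 1 _.+1%:Z); congr (_%:~R); lia.
rewrite !negintE; move: (z j 0) (z' j 0) => x y; nia.
Qed.

(** When z' dominates z in all wall distances, the ray from z through z' stays
in Lambda_J, so a weight bounded below cannot decrease along it.  Dickson's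
lemma then leaves finitely many candidates for the minimum. *)
Lemma Bw_vexp J : Bw w Lam J -> wmins w (Lam_ Lam J) (vexp w Lam J).
Proof.
move=> [/NSP[z0 Lz0 z0J] [_ [u0 Lu0 <-] [b b_le]]].
pose P : set 'cV[int]_n := [set z | L z /\ nsupp (E z) = J].
have [||z [Lz zJ] z_min] := @dickson_argmin _ R _ [seq wall_dist j | j <- enum 'I_n] P weight.
- by exists z0.
- move=> z z' [Lz zJ] [Lz' z'J]; rewrite all_map => /allP le_zz'.
  rewrite leNgt; apply/negP => lt_z'z.
  pose zk k : 'cV[int]_n := z + k%:Z *: (z' - z).
  have zkP k : Lam_ Lam J (E (zk k)).
    split.
      exists (zk k) => //; rewrite /zk /latticeL /= mulmxDr Lz add0r.
      by rewrite -scalemxAr mulmxBr Lz Lz' subrr scaler0.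
    rewrite -zJ; apply/setP => j; rewrite !in_nsupp /zk !mxE.
    apply: negint_translate; first by rewrite -!in_nsupp zJ z'J.
    by apply: le_zz'; rewrite mem_enum.
  (* Beyond this number of steps the weight on the ray would fall below b. *)
  pose x := (weight z - weight u0 - b) / (weight z - weight z').
  have lt_xk := le_lt_trans (ler_norm x) (archi_boundP (normr_ge0 x)).
  have := b_le _ (zkP (Num.bound `|x|)); rewrite dotwB_base lecR weight_line -pmulrn.
  move: lt_xk; rewrite ltr_pdivrMr ?subr_gt0 //; move: (_%:R) => k; lra.
apply: (@xgetPex _ 0 (wmins w (Lam_ Lam J))); exists (E z); split.
  by split=> //; exists z.
move=> _ [[u Lu <-] uJ]; apply/lew_base; exact: z_min.
Qed.

Lemma Aw_Bw J : Aw w Lam J -> Bw w Lam J.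
Proof. by move=> [NSJ sub]; apply: sub. Qed.

Lemma vexp_inj J J' : Aw w Lam J -> Aw w Lam J' ->
  vexp w Lam J = vexp w Lam J' -> J = J'.
Proof.
move=> /Aw_Bw/Bw_vexp[[_ nJ] _] /Aw_Bw/Bw_vexp[[_ nJ'] _] eqv.
by rewrite -nJ -nJ' eqv.
Qed.

(** The support of the series of c is the union of the Lambda_J with c_J <> 0,
and none of the minima v_J of these pieces precedes v_K. *)
Lemma Rexp_of_coeff K c : Aw w Lam K -> Coeffdir A w Lam c ->
  (forall J, Aw_lt w Lam K J -> c J = 0) -> c K <> 0 ->
  Rexp A beta w Lam (vexp w Lam K).
Proof.
move=> AwK [cA compat c0] clt cK.
have [[LamK KE] K_min] := Bw_vexp (Aw_Bw AwK).
have [phi suppL frob] := frobenius_series_exists lam A c.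
have [zK LzK zKE] := LamK.
have phiK : phi (vexp w Lam K) <> 0.
  by rewrite -zKE; apply/(frobenius_coeff_neq0 frob LzK); rewrite zKE KE.
have minK : wmins w (Supp phi) (vexp w Lam K).
  split=> // _ /[dup] /suppL[z Lz <-] /(frobenius_coeff_neq0 frob Lz) cz.
  set J := nsupp (E z) in cz.
  have NSJ : NS Lam J by apply/NSP; exists z.
  have AwJ : Aw w Lam J by apply: contrapT => /(c0 _ NSJ).
  have [[LamJ _] J_min] := Bw_vexp (Aw_Bw AwJ).
  have Lz' : Lam (E z) by exists z.
  apply: (lew_trans LamK LamJ Lz'); last by apply: J_min.
  have [//|le_JK] := lew_total LamK LamJ.
  have [->|neq] := pselect (vexp w Lam J = vexp w Lam K); first exact: lew_refl.
  by case: cz; apply: clt.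
exists phi; last exact: (wminP suppL minK).
split; last by move=> phi0; apply: phiK; rewrite phi0.
split=> //; last by right; exists (vexp w Lam K).
  move=> gam /suppL Lgam; exists gam => //; exists 0 => //.
  by rewrite /toC map_mx0 addr0.
exact/(HA_frobeniusP lam_beta suppL frob).
Qed.

(** K is the negative support of the initial exponent.  Components outside A_w
vanish because c_J = d^{J \ J'} . c_{J'} for J' in J: a nonzero c_J forces
Lambda_{J'} into the support, where the weight is bounded below. *)
Lemma coeff_of_Rexp gam : Rexp A beta w Lam gam ->
  exists K c, [/\ Aw w Lam K, gam = vexp w Lam K, Coeffdir A w Lam c,
    forall J, Aw_lt w Lam K J -> c J = 0 & c K <> 0].
Proof.
move=> [phi [[_ suppL annih [//|[gam' min_gam]]] phi0] <-].
rewrite /lexp (wminP suppL min_gam); have [supp_gam le_gam] := min_gam.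
have [c frob] := frobenius_coeff_exists lam annih.
have [cA compat] := (HA_frobeniusP lam_beta suppL frob).1 annih.
have [zK LzK zKE] := suppL _ supp_gam; set K := nsupp (E zK).
have suppJ J del : c J <> 0 -> Lam_ Lam J del -> Supp phi del.
  move=> cJ [[z Lz <-] zJ]; apply/(frobenius_coeff_neq0 frob Lz).
  by rewrite zJ.
have BwJ J : NS Lam J -> c J <> 0 -> Bw w Lam J.
  move=> NSJ cJ; split=> //; exists gam'; first exact: suppL.
  by exists 0 => del /(suppJ _ _ cJ)/le_gam.
have AwJ J : NS Lam J -> c J <> 0 -> Aw w Lam J.
  move=> NSJ cJ; split=> // J' NSJ' subJ; apply: BwJ => // cJ'; apply: cJ.
  have := compat J J' NSJ NSJ'; rewrite cJ' linear0.
  have -> : J' :\: J = finset.set0 by apply/eqP; rewrite finset.setD_eq0.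
  by rewrite /dset big_set0 dact1.
have NSK : NS Lam K by apply/NSP; exists zK.
have cK : c K <> 0.
  by apply/(frobenius_coeff_neq0 frob LzK); rewrite zKE.
have gamK : vexp w Lam K = gam'.
  apply: wminP; first exact: Lam_sub.
  split; first by split; [exact: suppL|rewrite -zKE].
  by move=> del /(suppJ _ _ cK)/le_gam.
exists K, c; split=> //; first exact: AwJ.
  split=> // J NSJ nAJ; apply: contrapT => cJ; apply: nAJ; exact: AwJ.
move=> J [AJ [le_JK neq_JK]]; apply: contrapT => cJ; apply: neq_JK.
have [LJ J_min] := Bw_vexp (Aw_Bw AJ); rewrite gamK in le_JK *.
apply: lew_anti => //; [exact: LJ.1|exact: suppL|].
by apply: le_gam; apply: suppJ cJ LJ.
Qed.

Lemma Clt_neq0P K : Aw w Lam K -> Clt A w Lam K <> [set 0] <->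
  exists c, [/\ Coeffdir A w Lam c, forall J, Aw_lt w Lam K J -> c J = 0 & c K <> 0].
Proof.
move=> AwK; split=> [neq|[c [cc clt cK]] eq0]; last first.
  by apply: cK; rewrite -[_ = _]/([set 0] (c K)) -eq0; exists c.
apply: contrapT => none; apply: neq; apply/seteqP; split=> [_ [c [cc clt] <-]|_ ->].
  by apply: contrapT => cK; apply: none; exists c.
by rewrite Clt_Solpoly // => f _; apply: linear0.
Qed.

Lemma RexpP K : Aw w Lam K ->
  Rexp A beta w Lam (vexp w Lam K) <-> Clt A w Lam K <> [set 0].
Proof.
move=> AwK; rewrite Clt_neq0P //; split=> [|[c [cc clt cK]]].
  by move=> /coeff_of_Rexp[K' [c [AwK' /(vexp_inj AwK AwK') <- cc clt cK]]]; exists c.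
exact: Rexp_of_coeff cK.
Qed.

End InitialExponents.

Theorem theorem6p6 (R : realType) (d n : nat) (A : 'M[int]_(d, n))
    (beta : 'cV[R[i]]_d) (w : 'cV[R]_n) (Lam : set 'cV[R[i]]_n) :
  \rank (map_mx intr A : 'M[rat]_(d, n)) = d ->
  L_generic A w ->
  exponent_lattice A beta Lam ->
  (forall K : {set 'I_n}, Aw w Lam K ->
    let QK := colon (Qlt A w Lam K) (dset R K) in
    [/\ Clt A w Lam K = Solpoly QK,
        AnnS (Clt A w Lam K) = QK,
        Rexp A beta w Lam (vexp w Lam K) <-> Clt A w Lam K <> [set 0] &
        Clt A w Lam K <> [set 0] <-> QK <> setT]) /\
  Rexp A beta w Lam =
    [set vexp w Lam K | K in
      [set K | Aw w Lam K /\ colon (Qlt A w Lam K) (dset R K) <> setT]].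
Proof.
move=> _ w_generic [lam lam_beta ->]; split=> [K AwK QK|].
  split; [exact: Clt_Solpoly|exact: AnnS_Clt|exact: RexpP|exact: Clt_neq0].
apply/seteqP; split=> [gam Rgam|_ [K [AwK QK] <-]]; last first.
  by apply/RexpP => //; apply/Clt_neq0.
have [K [c [AwK gamK cc clt cK]]] := coeff_of_Rexp w_generic lam_beta Rgam.
exists K; last by rewrite gamK.
by split=> //; apply/Clt_neq0 => //; apply/Clt_neq0P => //; exists c.
Qed.
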